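(* Let $a_1, a_2 \in \mathbb{R}_+$ and let $b_1, b_2 > 1$ be real numbers. For every $(x_1,x_2)\in \mathbb{X} := \mathbb{R}_+\times\mathbb{R}_+$ let $(x_n)_{n\ge 1}$ denote the unique solution of the recursion $$x_n = a_1 x_{n-1}^{b_1} + a_2 x_{n-2}^{b_2} \qquad \text{for all } n\ge 3$$ with the given initial values $(x_1,x_2)$, and let $$\mathbb{B} = \bigl\{ (x_1,x_2)\in \mathbb{X} : (x_n) \text{ is Benford}\bigr\}.$$ Then $\mathbb{B}$ has full measure but is meagre in $\mathbb{X}$.
   Context: $\mathbb{R}_+$ denotes the set of all (strictly) positive real numbers, and $\log$ denotes the base-$10$ logarithm. For $x\in\mathbb{R}_+$, the (decimal) significand $S(x)$ is the unique number $t\in[1,10)$ with $x = 10^k t$ for some $k\in\mathbb{Z}$; for $x<0$ let $S(x)=S(-x)$, and let $S(0)=0$. A real sequence $(x_n)=(x_1,x_2,x_3,\ldots)$ is called Benford if $$\lim_{N\to\infty} \frac{\#\{1\le n\le N : S(x_n)\le t\}}{N} = \log t \qquad \text{for all } t\in[1,10).$$ A set $\mathbb{B}$ has full measure in $\mathbb{Y}$ if $\mathbb{Y}\setminus\mathbb{B}$ is a Lebesgue nullset. A set $\mathbb{B}$ is meagre (of first category) in $\mathbb{Y}$ if $\mathbb{B}\cap\mathbb{Y}$ is a union of countably many nowhere dense sets in $\mathbb{Y}$. Here $\mathbb{X}=\mathbb{R}_+^2$ carries the usual topology and two-dimensional Lebesgue measure. *)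

(* Defs.v *)
From HB Require Import structures.
From mathcomp Require Import all_boot all_order all_algebra.
From mathcomp Require Import all_classical all_reals all_analysis.
Set Implicit Arguments.
Unset Strict Implicit.
Unset Printing Implicit Defensive.
Import Order.TTheory GRing.Theory Num.Theory.
Import numFieldNormedType.Exports.
Local Open Scope classical_set_scope.
Local Open Scope ring_scope.

Definition log10 {R : realType} (x : R) : R := ln x / ln 10.

(* For x != 0 the set below is a singleton; for x = 0 it is empty, and the
   default value of [xget] gives S(0) = 0. *)
Definition significand {R : realType} (x : R) : R :=
  xget 0 [set t : R | 1 <= t < 10 /\ exists k : int, `|x| = 10 ^ k * t].

(* Sequences are indexed from 0: [u i] is the mathematical x_(i+1), so that
   i < N corresponds to 1 <= n <= N. *)
Definition benford {R : realType} (u : nat -> R) : Prop :=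
  forall t : R, 1 <= t < 10 ->
    (fun N : nat => #|[pred i : 'I_N | significand (u i) <= t]|%:R / N%:R : R)
      @ \oo --> log10 t.

(* x_n = a1 x_(n-1)^b1 + a2 x_(n-2)^b2 with (x_1, x_2) = x, again with x_(i+1)
   at index i. *)
Fixpoint rec_seq {R : realType} (a1 a2 b1 b2 : R) (x : R * R) (i : nat) : R :=
  match i with
  | 0 => x.1
  | 1 => x.2
  | (k.+1 as j).+1 => a1 * rec_seq a1 a2 b1 b2 x j `^ b1
                      + a2 * rec_seq a1 a2 b1 b2 x k `^ b2
  end.

Definition pos_quadrant {R : realType} : set (R * R) :=
  [set x | 0 < x.1 /\ 0 < x.2].

(* [negligible] only asks for inclusion in a measurable null set, so with the
   product of Borel sigma-algebras it describes all Lebesgue nullsets. *)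
Definition full_measure_in {R : realType} (Y B : set (R * R)) : Prop :=
  ((@lebesgue_measure R) \x (@lebesgue_measure R))%E.-negligible (Y `\` B).

Definition nowhere_dense {T : topologicalType} (A : set T) : Prop :=
  (closure A)° = set0.

Definition meagre {T : topologicalType} (A : set T) : Prop :=
  exists F : nat -> set T,
    (forall n, nowhere_dense (F n)) /\ A = \bigcup_n F n.

(* Y is viewed as a space of its own, with the topology induced by T. *)
Definition meagre_in {T : topologicalType} (Y B : set T) : Prop :=
  meagre [set y : set_type Y | B (set_val y)].

(* Main.v *)
Require Import Defs.
From HB Require Import structures.
From mathcomp Require Import all_boot all_order all_algebra.
From mathcomp Require Import all_classical all_reals all_analysis.
From mathcomp Require Import measurable_realfun.
From mathcomp Require Import ring lra zify.
Import Order.TTheory GRing.Theory Num.Theory.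
Import numFieldNormedType.Exports.
Set Implicit Arguments.
Unset Strict Implicit.
Unset Printing Implicit Defensive.
Local Open Scope classical_set_scope.
Local Open Scope ring_scope.

(** Fix [x_1] and let [s = ln x_2] vary. As a function of [s], the logarithm
    [l_n = ln x_n] is convex and increasing, because a logarithm of a sum of
    exponentials is. Its slope [D_n] satisfies a linear recursion: [D_(n+2)] is
    the mean of [b1 D_(n+1)] and [b2 D_n] with weights [p_n] and [1 - p_n], the
    shares of the two terms of [x_(n+2)] ([slope_subgradient]).

    The only dynamical input is the growth estimate [family_growth]:
    [D_(m+2k) >= kap * rate^k * D_m] with [rate > 1], from some index on, uniformly
    for [s] in an interval on which the trajectories tend to infinity or to 0.
    Since [b1, b2 > 1], the smaller of two consecutive slopes grows
    geometrically, but single slopes might not. The weights repair this. When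
    [(b1^2 - b2) * ln x_n] is nonnegative, they stay away from 0 and consecutive
    slopes are comparable ([slope_growth_mixed]). When it tends to minus
    infinity, the weights are eventually small, at all indices or at every
    second one ([weight_alternation], [slope_growth_alternating]). Intervals to
    which the estimate applies leave out at most one value of [s], because the
    slopes are unbounded ([family_dichotomy]).

    Full measure. A convex function with slope at least [d] is equidistributed
    modulo one on an interval up to an error [1 / d]: this is seen period by
    period, since convexity orders the lengths of the pieces ([mass_window]).
    Applied on each period of [l_m], it shows that the windows hit by [l_m] and
    [l_n] are nearly independent once [l_n] is much steeper than [l_m]
    ([covar_bound]). By the growth estimate the correlations of indices of equal
    parity decay geometrically, and a second moment argument ([cesaro_ae]) gives
    equidistribution of [log10 x_n] modulo one for almost every [s], which is the
    Benford property ([benford_of_cesaro]). Tonelli's theorem then treats the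
    quadrant.

    Meagreness. Within [2K] steps an interval of values of [s] on which [log10 x_n]
    runs through a window of length [1 / (4K)] modulo one is stretched to length
    2, if [K] is large. Nested intervals therefore produce, near any initial value,
    sequences that hit this window at every [2K]-th index, twice too often for
    a Benford sequence ([nested_hits]). Hitting it too often up to a given time is
    an open condition, so the Benford initial values lie in countably many
    closed sets without interior ([benford_meagre]). *)

(** * Trajectories and their logarithmic slopes *)

Definition solution {R : realType} (a1 a2 b1 b2 : R) (x : nat -> R) : Prop :=
  [/\ 0 < x 0, 0 < x 1 &
      forall n, x n.+2 = a1 * x n.+1 `^ b1 + a2 * x n `^ b2].

(** The share of the first term in the sum [x n.+2]. *)
Definition weight {R : realType} (a1 b1 : R) (x : nat -> R) (n : nat) : R :=
  a1 * x n.+1 `^ b1 / x n.+2.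

(** When [p] is the sequence of weights of a trajectory, this is the derivative of
[ln (x n)] with respect to [ln (x 1)] for a fixed value of [x 0]. *)
Fixpoint slope {R : realType} (b1 b2 : R) (p : nat -> R) (n : nat) : R :=
  match n with
  | 0 => 0
  | 1 => 1
  | (k.+1 as j).+1 => p k * b1 * slope b1 b2 p j
                      + (1 - p k) * b2 * slope b1 b2 p k
  end.

Lemma slopeSS {R : realType} (b1 b2 : R) p n : slope b1 b2 p n.+2 =
  p n * b1 * slope b1 b2 p n.+1 + (1 - p n) * b2 * slope b1 b2 p n.
Proof. by []. Qed.

Lemma ln_concave {R : realType} (p q u v : R) : 0 < p -> 0 < q -> p + q = 1 ->
  0 < u -> 0 < v -> p * ln u + q * ln v <= ln (p * u + q * v).
Proof.
move=> p0 q0 pq u0 v0; set z := p * u + q * v.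
have z0 : 0 < z by rewrite addr_gt0 // mulr_gt0.
have tangent (w : R) : 0 < w -> ln w <= ln z + (w / z - 1).
  move=> w0; have -> : w = z * (1 + (w / z - 1)) by field; rewrite gt_eqF.
  rewrite lnM ?posrE //; last by rewrite subrKC divr_gt0.
  rewrite lerD2l (_ : z * _ / z - 1 = w / z - 1); last by field; rewrite gt_eqF.
  by apply: le_ln1Dx; rewrite ltrBrDr addNr divr_gt0.
have hu := tangent _ u0; have hv := tangent _ v0.
have e : p * (u / z) + q * (v / z) = 1.
  by rewrite !mulrA -mulrDl divff // gt_eqF.
have := lerD (ler_wpM2l (ltW p0) hu) (ler_wpM2l (ltW q0) hv).
have -> : p * (ln z + (u / z - 1)) + q * (ln z + (v / z - 1)) =
  (p + q) * ln z + (p * (u / z) + q * (v / z)) - (p + q) by ring.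
by rewrite e pq mul1r addrK.
Qed.

Lemma subgradient_mono {R : realType} (f d : R -> R) :
  (forall s t, d s * (t - s) <= f t - f s) -> {homo d : s t / s <= t}.
Proof.
move=> sub s t; rewrite le_eqVlt => /predU1P[->//|st].
have h1 := sub s t; have h2 := sub t s.
rewrite -(@ler_pM2r _ (t - s)) ?subr_gt0 //; apply: (le_trans h1).
by move: h2; lra.
Qed.

Section Solution.
Context {R : realType}.
Variables (a1 a2 b1 b2 : R).
Hypotheses (a1_gt0 : 0 < a1) (a2_gt0 : 0 < a2).
Hypotheses (b1_gt1 : 1 < b1) (b2_gt1 : 1 < b2).

Lemma solution_gt0 x n : solution a1 a2 b1 b2 x -> 0 < x n.
Proof.
case=> x0 x1 xS.
suff [] : 0 < x n /\ 0 < x n.+1 by [].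
elim: n => [//|n [IH1 IH2]]; split => //.
by rewrite xS addr_gt0 // mulr_gt0 // powR_gt0.
Qed.

Lemma weight_compl x n : solution a1 a2 b1 b2 x ->
  1 - weight a1 b1 x n = a2 * x n `^ b2 / x n.+2.
Proof.
move=> sx; have x2 := solution_gt0 n.+2 sx; have [_ _ xS] := sx.
rewrite /weight -[X in X - _](@divff _ (x n.+2)) ?gt_eqF // -mulrBl.
by rewrite {1}xS addrAC subrr add0r.
Qed.

Lemma weight_gt0 x n : solution a1 a2 b1 b2 x -> 0 < weight a1 b1 x n.
Proof.
by move=> sx; rewrite divr_gt0 ?mulr_gt0 ?powR_gt0 //; apply: solution_gt0 sx.
Qed.

Lemma weight_lt1 x n : solution a1 a2 b1 b2 x -> weight a1 b1 x n < 1.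
Proof.
move=> sx; rewrite -subr_gt0 weight_compl //.
by rewrite divr_gt0 ?mulr_gt0 ?powR_gt0 //; apply: solution_gt0 sx.
Qed.

Lemma ln_weight x n : solution a1 a2 b1 b2 x ->
  ln (x n.+2) = ln a1 + b1 * ln (x n.+1) - ln (weight a1 b1 x n).
Proof.
move=> sx; have h k := solution_gt0 k sx.
rewrite /weight ln_div ?posrE ?mulr_gt0 ?powR_gt0 //.
by rewrite lnM ?posrE ?powR_gt0 // ln_powR; ring.
Qed.

Lemma ln_weight_compl x n : solution a1 a2 b1 b2 x ->
  ln (x n.+2) = ln a2 + b2 * ln (x n) - ln (1 - weight a1 b1 x n).
Proof.
move=> sx; have h k := solution_gt0 k sx.
rewrite weight_compl // ln_div ?posrE ?mulr_gt0 ?powR_gt0 //.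
by rewrite lnM ?posrE ?powR_gt0 // ln_powR; ring.
Qed.

(** [ln (x n.+2)] is the logarithm of a sum of exponentials of affine functions of
the two preceding logarithms, hence a convex increasing function of them whose
gradient is given by the weights. The supporting line passes through the
recursion by concavity of [ln], so nothing has to be differentiated. *)
Lemma slope_subgradient x y s t n :
  solution a1 a2 b1 b2 x -> solution a1 a2 b1 b2 y ->
  y 0 = x 0 -> ln (y 1) - ln (x 1) = t - s ->
  slope b1 b2 (weight a1 b1 x) n * (t - s) <= ln (y n) - ln (x n).
Proof.
move=> sx sy e0 e1; pose D := slope b1 b2 (weight a1 b1 x).
suff [] : D n * (t - s) <= ln (y n) - ln (x n) /\
          D n.+1 * (t - s) <= ln (y n.+1) - ln (x n.+1) by [].
elim: n => [|n [IH0 IH1]].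
  by rewrite /D /= mul0r mul1r e0 e1 subrr.
split=> //; rewrite -/(D n) -/(D n.+1) in IH0 IH1 *.
have hx k := solution_gt0 k sx; have hy k := solution_gt0 k sy.
have p0 := weight_gt0 n sx; have p1 := weight_lt1 n sx.
rewrite /D slopeSS -/(D n) -/(D n.+1); set p := weight a1 b1 x n.
apply: le_trans (_ : p * (b1 * (ln (y n.+1) - ln (x n.+1))) +
   (1 - p) * (b2 * (ln (y n) - ln (x n))) <= _).
  have h1 := ler_wpM2l (ltW (mulr_gt0 p0 (lt_trans ltr01 b1_gt1))) IH1.
  have q0 : 0 < 1 - p by rewrite subr_gt0.
  have h2 := ler_wpM2l (ltW (mulr_gt0 q0 (lt_trans ltr01 b2_gt1))) IH0.
  apply: le_trans (le_trans (lerD h1 h2) _); rewrite le_eqVlt; apply/orP; left.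
    by apply/eqP; rewrite /p; ring.
  by apply/eqP; rewrite /p; ring.
have -> : b1 * (ln (y n.+1) - ln (x n.+1)) =
    ln (y n.+1 `^ b1 / x n.+1 `^ b1).
  by rewrite ln_div ?posrE ?powR_gt0 // !ln_powR mulrBr.
have -> : b2 * (ln (y n) - ln (x n)) = ln (y n `^ b2 / x n `^ b2).
  by rewrite ln_div ?posrE ?powR_gt0 // !ln_powR mulrBr.
rewrite -ln_div ?posrE //.
apply: le_trans (ln_concave _ _ _ _ _) _ => //.
- by rewrite subr_gt0.
- by rewrite subrKC.
- by rewrite divr_gt0 ?powR_gt0.
- by rewrite divr_gt0 ?powR_gt0.
rewrite weight_compl // /p /weight le_eqVlt; apply/orP; left; apply/eqP.
have [_ _ ->] := sy; congr ln.
field; rewrite !gt_eqF //; by rewrite powR_gt0.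
Qed.

Lemma slope_gt0 p n : (forall n, 0 < p n < 1) -> 0 < slope b1 b2 p n.+1.
Proof.
move=> hp; pose D := slope b1 b2 p.
suff [] : 0 <= D n /\ 0 < D n.+1 by [].
elim: n => [//|n [IH0 IH1]]; split; first exact: ltW.
have /andP[p0 p1] := hp n.
rewrite /D slopeSS -/(D n) -/(D n.+1) ltr_pwDl //.
  by rewrite !mulr_gt0 // (lt_trans ltr01).
by rewrite !mulr_ge0 // ?subr_ge0 ltW // (lt_trans ltr01).
Qed.

End Solution.

(** * Growth of the slopes *)

Section Growth.
Context {R : realType}.
Variables (b1 b2 lam : R) (p : nat -> R).
Hypotheses (b1_gt1 : 1 < b1) (b2_gt1 : 1 < b2).
Hypotheses (lam_gt1 : 1 < lam) (lam_b1 : lam <= b1) (lam_b2 : lam <= b2).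
Hypothesis p01 : forall n, 0 < p n < 1.
Notation D := (slope b1 b2 p).

Let D_ge0 n : 0 <= D n.
Proof. by case: n => [//|n]; rewrite ltW // slope_gt0. Qed.

(** The smaller of two consecutive slopes grows geometrically, since each new slope
is a mean of [b1] and [b2] times the two before. A single slope gives no such
control: consecutive slopes may live on very different scales. *)
Lemma slope_growth_pair c m k : 0 <= c -> c <= D m -> c <= D m.+1 ->
  lam ^+ k * c <= D (m + k.*2) /\ lam ^+ k * c <= D (m + k.*2).+1.
Proof.
move=> c0 c1 c2; have l0 : 0 < lam := lt_trans ltr01 lam_gt1.
have step n z : 0 <= z -> z <= D n -> z <= D n.+1 -> lam * z <= D n.+2.
  move=> z0 z1 z2; have /andP[p0 p1] := p01 n.
  have -> : lam * z = p n * (lam * z) + (1 - p n) * (lam * z) by ring.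
  rewrite slopeSS -!mulrA; apply: lerD; apply: ler_wpM2l.
  - exact: ltW.
  - by apply: ler_pM => //; rewrite ltW.
  - by rewrite subr_ge0 ltW.
  - by apply: ler_pM => //; rewrite ltW.
elim: k => [|k [IH1 IH2]]; first by rewrite expr0 mul1r addn0.
have lk : 0 <= lam ^+ k * c by rewrite mulr_ge0 // exprn_ge0 // ltW.
have h := step _ _ lk IH1 IH2; rewrite doubleS !addnS exprS -mulrA; split=> //.
apply: step => //; apply: le_trans h.
by rewrite ler_peMl // ltW.
Qed.

(** If the weights stay away from 0, a slope is never small compared with the one
before, so [slope_growth_pair] controls every single slope. *)
Lemma slope_growth_mixed (pm : R) n0 : 0 < pm ->
  (forall n, (n0 <= n)%N -> pm <= p n) ->
  forall m k, (n0 < m)%N ->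
  Num.min 1 (pm * b1) * lam ^+ k * D m <= D (m + k.*2).
Proof.
move=> pm0 hp m k; case: m => // m n0m.
have /andP[p0 p1] := p01 m.
rewrite mulrAC mulrC; set c := Num.min _ _.
have c0 : 0 < c by rewrite lt_min ltr01 mulr_gt0 // (lt_trans ltr01).
apply: (slope_growth_pair k _ _ _).1.
- by rewrite mulr_ge0 // ltW.
- by rewrite ler_piMl // ge_min lexx.
rewrite slopeSS ler_wpDr //.
  by rewrite !mulr_ge0 // ?subr_ge0 ltW // (lt_trans ltr01).
apply: ler_wpM2r => //; apply: (@le_trans _ _ (pm * b1)).
  by rewrite ge_min lexx orbT.
by rewrite ler_pM2r ?hp // (lt_trans ltr01).
Qed.

Section Alternating.
Variables (e S : R) (n0 : nat).
Hypotheses (e_gt0 : 0 < e) (e_lt1 : e < 1) (lam_e : lam <= (1 - e) * b2).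
Hypothesis high_low : forall n, (n0 <= n)%N -> e <= p n -> p n.+1 <= e / 2.
Hypothesis low_low : forall n, (n0 <= n)%N ->
  p n < e -> p n.+1 < e -> p n.+2 < e.

Let b1_gt0 : 0 < b1 := lt_trans ltr01 b1_gt1.
Let b2_gt0 : 0 < b2 := lt_trans ltr01 b2_gt1.
Let theta : R := (1 - e) / (1 - e / 2).
Let B : R := b1 / (1 - theta).

Let theta_lt1 : theta < 1.
Proof. by rewrite /theta ltr_pdivrMr; move: e_gt0 e_lt1; lra. Qed.

Let theta_gt0 : 0 < theta.
Proof. by rewrite /theta; apply: divr_gt0; move: e_gt0 e_lt1; lra. Qed.

Let B_gt0 : 0 < B.
Proof. by rewrite /B divr_gt0 // subr_gt0. Qed.

(** Call a weight high if it is at least [e], and low otherwise. After two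
consecutive low weights all weights are low; so, read backwards from a high
weight, high and low weights alternate. *)
Lemma high_low_high n : (n0 <= n)%N -> e <= p n.+2 -> e <= p n /\ p n.+1 <= e / 2.
Proof.
move=> hn h2; have [h1|h1] := leP e (p n.+1).
  by have := high_low (leqW hn) h1; move: e_gt0 e_lt1; lra.
have [h0|h0] := leP e (p n); first by split => //; apply: high_low.
by have := low_low hn h0 h1; rewrite ltNge h2.
Qed.

Lemma slope_low n : p n <= e -> lam * D n <= D n.+2.
Proof.
move=> pe; have /andP[p0 p1] := p01 n.
rewrite slopeSS ler_wpDl //; first by rewrite !mulr_ge0 // ltW.
apply: ler_wpM2r => //; apply: (le_trans lam_e).
by rewrite ler_pM2r //; move: e_gt0 e_lt1; lra.
Qed.

(** Along the high positions, the ratio of a slope to its predecessor obeys an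
affine recursion with factor [theta < 1]: the slope two steps back enters with
weight at most [1 - e], whereas the preceding low position keeps at least
[1 - e / 2] of the slope two steps before it. The initial ratio [S] is thus
forgotten, and the growth constant below does not depend on the trajectory. *)
Lemma high_ratio n1 j : (n0 <= n1)%N -> 0 <= S -> D n1.+2 <= S * D n1.+1 ->
  e <= p (n1 + j.*2) ->
  D (n1 + j.*2).+2 <= (B + theta ^+ j * S) * D (n1 + j.*2).+1.
Proof.
move=> n01 S0 hS; elim: j => [|j IH]; rewrite ?addn0.
  move=> _; rewrite expr0 mul1r (le_trans hS) // ler_wpM2r // lerDr.
  exact: ltW.
rewrite doubleS !addnS; set n := (n1 + j.*2)%N in IH * => h2.
have hn : (n0 <= n)%N by rewrite (leq_trans n01) // leq_addr.
have [h0 h1] := high_low_high hn h2; have {}IH := IH h0.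
set r := (B + _) in IH; rewrite exprS.
have r0 : 0 <= r.
  by apply: addr_ge0; [exact: ltW | rewrite mulr_ge0 // exprn_ge0 // ltW].
have -> : B + theta * theta ^+ j * S = b1 + theta * r.
  by rewrite /r /B; field; rewrite subr_eq0 gt_eqF.
have /andP[p0 p1] := p01 n.+2; have /andP[q0 q1] := p01 n.+1.
have hD3 : (1 - e / 2) * b2 * D n.+1 <= D n.+3.
  rewrite slopeSS ler_wpDl //; first by rewrite !mulr_ge0 // ltW.
  by rewrite !ler_wpM2r // ?lerD2l ?lerN2 // ltW.
rewrite slopeSS [leRHS]mulrDl lerD //.
  by rewrite ler_wpM2r // ler_piMl // ltW.
apply: (@le_trans _ _ ((1 - e) * b2 * (r * D n.+1))).
  apply: ler_pM => //; first by rewrite mulr_ge0 // ?subr_ge0 ltW.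
  by rewrite ler_pM2r // lerD2l lerN2.
have -> : (1 - e) * b2 * (r * D n.+1) =
    theta * r * ((1 - e / 2) * b2 * D n.+1).
  by rewrite /theta; field; move: e_gt0 e_lt1; lra.
by rewrite ler_wpM2l // mulr_ge0 // ltW.
Qed.

(** A low position gains the factor [lam] over the slope two steps back. High
positions are compared through the low positions just before them, at the cost
of the constant ratio from [high_ratio]. *)
Lemma slope_growth_alternating j0 : 0 <= S -> theta ^+ j0 * S <= 1 ->
  D n0.+2 <= S * D n0.+1 -> D n0.+3 <= S * D n0.+2 ->
  forall m k, (n0 + j0.*2 <= m)%N ->
  Num.min 1 (e * b1 / (B + 1)) * lam ^+ k * D m.+2 <= D (m.+2 + k.*2).
Proof.
move=> S0 hj0 hS0 hS1 m k hm.
have l0 : 0 < lam := lt_trans ltr01 lam_gt1.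
have hn : (n0 <= m)%N by rewrite (leq_trans _ hm) // leq_addr.
have ratio : e <= p m -> D m.+2 <= (B + 1) * D m.+1.
  have hj j : (j0 <= j)%N -> theta ^+ j * S <= 1.
    move=> jj; apply: le_trans hj0; rewrite ler_wpM2r //.
    by apply: ler_wiXn2l => //; apply: ltW.
  have [n1 [j [n01 h1 jj ->]]] : exists n1 j, [/\ (n0 <= n1)%N,
      D n1.+2 <= S * D n1.+1, (j0 <= j)%N & m = (n1 + j.*2)%N].
    have e1 : m = (n0 + (odd (m - n0) + (m - n0)./2.*2))%N.
      by rewrite odd_double_half subnKC.
    have le2 : (j0 <= (m - n0)./2)%N.
      by rewrite -(doubleK j0) half_leq // leq_subRL.
    case: (odd _) e1 => e1.
      by exists n0.+1, (m - n0)./2; split; rewrite // addSnnS.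
    by exists n0, (m - n0)./2; split.
  move=> h; apply: le_trans (high_ratio n01 S0 h1 h) _.
  by rewrite ler_wpM2r // lerD2l hj.
set kap := Num.min _ _.
have B1 : 0 < B + 1 by rewrite addr_gt0.
have run j : e <= p (m + j.*2) ->
    e <= p m /\ lam ^+ j * D m.+1 <= D (m + j.*2).+1.
  elim: j => [|j IH]; first by rewrite addn0 expr0 mul1r.
  rewrite doubleS !addnS => h2.
  have hnj : (n0 <= m + j.*2)%N by rewrite (leq_trans hn) // leq_addr.
  have [h0 h1] := high_low_high hnj h2.
  have [h3 h4] := IH h0; split=> //.
  apply: le_trans (slope_low (n := (m + j.*2).+1) _); last by move: e_gt0 e_lt1; lra.
  by rewrite exprS -mulrA ler_pM2l.
elim: k => [|k IH].
  rewrite addn0 expr0 mulr1 ler_piMl // /kap.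
  by rewrite ge_min lexx.
rewrite doubleS !addnS !addSn in IH *.
have [h|h] := leP e (p (m + k.*2).+2); last first.
  apply: le_trans (slope_low (ltW h)).
  by rewrite exprS mulrCA -mulrA ler_pM2l.
have h' : e <= p (m + k.+1.*2) by rewrite doubleS !addnS.
have [h0 h1] := run k.+1 h'; have {}ratio := ratio h0.
have /andP[p0 p1] := p01 (m + k.*2).+2.
rewrite [leRHS]slopeSS; apply: ler_wpDr.
  by rewrite mulr_ge0 // mulr_ge0 ?subr_ge0 // ltW.
apply: (@le_trans _ _ (e * b1 * (lam ^+ k.+1 * D m.+1))); last first.
  apply: ler_pM.
  - by rewrite mulr_ge0 // ltW.
  - by rewrite mulr_ge0 // exprn_ge0 // ltW.
  - by rewrite ler_pM2r.
  by rewrite doubleS !addnS in h1.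
apply: (@le_trans _ _ (e * b1 / (B + 1) * lam ^+ k.+1 * D m.+2)).
  rewrite ler_wpM2r // ler_pM2r ?exprn_gt0 //.
  by rewrite /kap ge_min lexx orbT.
have -> : e * b1 / (B + 1) * lam ^+ k.+1 * D m.+2 =
  e * b1 * (lam ^+ k.+1 * (D m.+2 / (B + 1))) by ring.
rewrite ler_pM2l ?mulr_gt0 // ler_pM2l ?exprn_gt0 //.
by rewrite ler_pdivrMr // mulrC.
Qed.

End Alternating.
End Growth.

(** * Weights along a trajectory *)

Definition escapes {R : realType} (x : nat -> R) :=
  forall Y : R, exists n0, forall n, (n0 <= n)%N -> Y <= ln (x n).
Definition vanishes {R : realType} (x : nat -> R) :=
  forall Y : R, exists n0, forall n, (n0 <= n)%N -> ln (x n) <= - Y.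

Section Weights.
Context {R : realType}.
Variables (a1 a2 b1 b2 : R).
Hypotheses (a1_gt0 : 0 < a1) (a2_gt0 : 0 < a2).
Hypotheses (b1_gt1 : 1 < b1) (b2_gt1 : 1 < b2).
Notation sol := (solution a1 a2 b1 b2).
Notation wt := (weight a1 b1).

Let c1 : R := (1 + b1) * ln a1 - ln a2.
Let c2 : R := (1 - b2) * ln a1 + (b1 - 1) * ln a2.

(** The size of the trajectory enters with the factor [b1 ^+ 2 - b2]; its sign and
the fate of the trajectory decide which of the two growth lemmas applies. *)
Lemma weight_odds1 x n : sol x ->
  ln (wt x n.+1) - ln (1 - wt x n.+1) =
  c1 + (b1 ^+ 2 - b2) * ln (x n.+1) - b1 * ln (wt x n).
Proof.
move=> sx; have h := ln_weight a1_gt0 a2_gt0 n sx.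
have h1 := ln_weight a1_gt0 a2_gt0 n.+1 sx.
have h2 := ln_weight_compl a1_gt0 a2_gt0 n.+1 sx.
have -> : ln (wt x n.+1) - ln (1 - wt x n.+1) =
  ln a1 + b1 * ln (x n.+2) - ln a2 - b2 * ln (x n.+1).
  by move: h1 h2 => -> h2; lra.
by rewrite h /c1; ring.
Qed.

(** Over two steps the size of the trajectory cancels. *)
Lemma weight_odds2 x n : sol x ->
  ln (wt x n.+2) - ln (1 - wt x n.+2) =
  c2 - b1 * ln (1 - wt x n.+1) + b2 * ln (wt x n).
Proof.
move=> sx; rewrite weight_odds1 //.
have h := ln_weight a1_gt0 a2_gt0 n sx.
have h1 := ln_weight a1_gt0 a2_gt0 n.+1 sx.
have h2 := ln_weight_compl a1_gt0 a2_gt0 n.+1 sx.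
have -> : ln (wt x n.+1) = ln a1 + b1 * ln (x n.+2) - ln (x n.+3).
  by rewrite h1; ring.
by rewrite h2 h /c1 /c2; ring.
Qed.

Let ln_wt_le0 x n : sol x -> ln (wt x n) <= 0.
Proof. by move=> sx; rewrite ln_le0 // ltW // (weight_lt1 a1_gt0 a2_gt0 n sx). Qed.

Let ln_wtC_le0 x n : sol x -> ln (1 - wt x n) <= 0.
Proof.
by move=> sx; rewrite ln_le0 // lerBlDr lerDl ltW // (weight_gt0 a1_gt0 a2_gt0 n sx).
Qed.

(** By [weight_odds1] the odds of the weight are at least [expR c1]. *)
Lemma weight_lower : exists2 pm, 0 < pm & forall x n, sol x ->
  0 <= (b1 ^+ 2 - b2) * ln (x n.+1) -> pm <= wt x n.+1.
Proof.
exists (expR c1 / (1 + expR c1)); first by rewrite divr_gt0 ?addr_gt0 ?expR_gt0.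
move=> x n sx hn; have p0 := weight_gt0 a1_gt0 a2_gt0 n.+1 sx.
have p1 := weight_lt1 a1_gt0 a2_gt0 n.+1 sx.
have : c1 + ln (1 - wt x n.+1) <= ln (wt x n.+1).
  have := weight_odds1 n sx; have := ln_wt_le0 n sx => h1 h2.
  rewrite -lerBrDr h2 -addrA lerDl addr_ge0 //.
  by rewrite -mulrN mulr_ge0 ?oppr_ge0 // ltW // (lt_trans ltr01).
rewrite -ler_expR expRD !lnK ?posrE ?subr_gt0 // => h.
by rewrite ler_pdivrMr ?addr_gt0 ?expR_gt0 //; move: h; lra.
Qed.

(** By [weight_odds1] the weight following a high one is tiny. After two low
weights, [weight_odds2] bounds the next one by a constant times the power [b2]
of the first of them, which is below that weight when [e] is small because
[b2 > 1]. *)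
Lemma weight_alternation lam : lam < b2 -> exists e Y, [/\ 0 < e, e < 1,
  lam <= (1 - e) * b2 &
  forall x n0, sol x ->
  (forall n, (n0 <= n)%N -> (b1 ^+ 2 - b2) * ln (x n) <= - Y) ->
  (forall n, (n0 <= n)%N -> e <= wt x n -> wt x n.+1 <= e / 2) /\
  (forall n, (n0 <= n)%N -> wt x n < e -> wt x n.+1 < e -> wt x n.+2 < e)].
Proof.
move=> lamb2.
have b1_gt0 : 0 < b1 := lt_trans ltr01 b1_gt1.
have b2_gt0 : 0 < b2 := lt_trans ltr01 b2_gt1.
have b21 : 0 < b2 - 1 by rewrite subr_gt0.
(* Below [e3] a low weight decreases over two steps. *)
pose e3 : R := expR (- (c2 + b1 * ln 2) / (b2 - 1)).
pose e : R := Num.min (1 / 2) (Num.min (1 - lam / b2) e3).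
have e_gt0 : 0 < e.
  rewrite /e !lt_min; apply/and3P; split; [by lra | | exact: expR_gt0].
  by rewrite subr_gt0 ltr_pdivrMr // mul1r.
have e_half : e <= 1 / 2 by rewrite /e ge_min lexx.
have e_lam : e <= 1 - lam / b2 by rewrite /e !ge_min lexx orbT.
have e_e3 : e <= e3 by rewrite /e !ge_min lexx !orbT.
exists e, (c1 - b1 * ln e - ln (e / 2)); split=> //.
- by lra.
- by rewrite -ler_pdivrMr //; lra.
move=> x n0 sx hx; split=> n hn.
  move=> hp; have p0 k := weight_gt0 a1_gt0 a2_gt0 k sx.
  have h1 := weight_odds1 n sx; have h2 := ln_wtC_le0 n.+1 sx.
  have h3 := hx n.+1 (leqW hn).
  rewrite -ler_ln ?posrE; [| exact: p0 | by rewrite divr_gt0].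
  have h4 : b1 * ln e <= b1 * ln (wt x n).
    by rewrite ler_pM2l // ler_ln ?posrE.
  by lra.
move=> hp hq; have p0 k := weight_gt0 a1_gt0 a2_gt0 k sx.
have h1 := weight_odds2 n sx; have h2 := ln_wtC_le0 n.+2 sx.
have lp : ln (wt x n) < ln e by rewrite ltr_ln ?posrE.
have hl : (b2 - 1) * ln (wt x n) < (b2 - 1) * ln e by rewrite ltr_pM2l.
rewrite -ltr_ln ?posrE //; apply: lt_trans lp.
have hq2 : - b1 * ln (1 - wt x n.+1) <= b1 * ln 2.
  rewrite mulNr -mulrN ler_pM2l // -lnV ?posrE; last by lra.
  rewrite ler_ln ?posrE ?invr_gt0 //; last by lra.
  by rewrite -[leRHS]invrK lef_pV2 ?posrE ?invr_gt0 //; lra.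
have he : (b2 - 1) * ln e <= - (c2 + b1 * ln 2).
  by rewrite mulrC -ler_pdivlMr // -[leRHS]expRK ler_ln ?posrE ?expR_gt0 //.
by lra.
Qed.

(** For large [x] the first term alone, a power with exponent above 1, makes
[ln x] increase by at least 1 in each step. *)
Lemma trap_up : exists2 M : R, 0 <= M & forall x n, sol x ->
  M <= ln (x n.+1) -> escapes x.
Proof.
have b10 : 0 < b1 - 1 by rewrite subr_gt0.
pose M : R := Num.max 0 ((1 - ln a1) / (b1 - 1)).
exists M; first by rewrite le_max lexx.
move=> x n sx hM.
have M1 : 1 - ln a1 <= (b1 - 1) * M.
  by rewrite mulrC -ler_pdivrMr // le_max lexx orbT.
have M0 : 0 <= M by rewrite le_max lexx.
have step k : M <= ln (x k.+1) -> ln (x k.+1) + 1 <= ln (x k.+2).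
  move=> hk; rewrite (ln_weight a1_gt0 a2_gt0 k sx).
  have := ln_wt_le0 k sx.
  have : (b1 - 1) * M <= (b1 - 1) * ln (x k.+1) by rewrite ler_pM2l.
  by lra.
have lin k : M + k%:R <= ln (x (n + k).+1).
  elim: k => [|k IH]; first by rewrite addr0 addn0.
  rewrite addnS -natr1 addrA; apply: le_trans (step _ _).
    by rewrite lerD2r.
  by apply: le_trans IH; rewrite lerDl.
move=> Y; have [k hk] : exists k : nat, Y <= k%:R.
  by exists (Num.truncn Y).+1; rewrite ltW // truncnS_gt.
exists (n + k).+1 => m hm; have -> : m = (n + (m.-1 - n)).+1.
  case: m hm => // m; rewrite ltnS => hm /=; rewrite subnKC //.
  by apply: leq_trans hm; rewrite leq_addr.
apply: le_trans (lin _).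
apply: (le_trans hk); apply: (le_trans (y := (m.-1 - n)%:R)); last by rewrite lerDr.
case: m hm => // m; rewrite ltnS /= => hm.
by rewrite ler_nat leq_subRL // (leq_trans _ hm) // leq_addr.
Qed.

(** One of the two terms is at least half of the sum, so up to [ln 2] the new
logarithm is that of a single power; as both exponents exceed 1 it drops by at
least 1 below the larger of the two preceding ones. *)
Lemma trap_down : exists2 M : R, 0 <= M & forall x n, sol x ->
  ln (x n) <= - M -> ln (x n.+1) <= - M -> vanishes x.
Proof.
have b10 : 0 < b1 - 1 by rewrite subr_gt0.
have b20 : 0 < b2 - 1 by rewrite subr_gt0.
pose M : R := Num.max 0 (Num.max ((1 + ln a1 + ln 2) / (b1 - 1))
   ((1 + ln a2 + ln 2) / (b2 - 1))).
exists M; first by rewrite le_max lexx.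
have M0 : 0 <= M by rewrite le_max lexx.
have M1 : 1 + ln a1 + ln 2 <= (b1 - 1) * M.
  by rewrite mulrC -ler_pdivrMr // !le_max lexx !orbT.
have M2 : 1 + ln a2 + ln 2 <= (b2 - 1) * M.
  by rewrite mulrC -ler_pdivrMr // !le_max lexx !orbT.
move=> x n sx h0 h1.
have lnhalf (q : R) : 1 / 2 <= q -> - ln q <= ln 2.
  move=> hq; have q0 : 0 < q by lra.
  rewrite lerNl -lnV ?posrE ?ler_ln ?posrE ?invr_gt0 //.
  by move: hq; rewrite div1r.
have step k c : M <= c -> ln (x k) <= - c -> ln (x k.+1) <= - c ->
    ln (x k.+2) <= - (c + 1).
  move=> hc hk0 hk1.
  have [hp|hp] := leP (1 / 2) (wt x k).
    rewrite (ln_weight a1_gt0 a2_gt0 k sx).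
    have := lnhalf _ hp.
    have : (b1 - 1) * M <= (b1 - 1) * (- ln (x k.+1)) by rewrite ler_pM2l //; lra.
    by lra.
  rewrite (ln_weight_compl a1_gt0 a2_gt0 k sx).
  have : 1 / 2 <= 1 - wt x k by lra.
  move/lnhalf.
  have : (b2 - 1) * M <= (b2 - 1) * (- ln (x k)) by rewrite ler_pM2l //; lra.
  by lra.
have lin k : ln (x (n + k.*2)%N) <= - (M + k%:R) /\
             ln (x (n + k.*2).+1) <= - (M + k%:R).
  elim: k => [|k [IH0 IH1]]; first by rewrite double0 addn0 mulr0n !addr0.
  have hk : 0 <= k%:R :> R by [].
  have Mk : M <= M + k%:R by lra.
  have s0 := step _ _ Mk IH0 IH1.
  rewrite doubleS !addnS -natr1 addrA; split=> //.
  have Mk1 : - (M + k%:R + 1) <= - (M + k%:R) by lra.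
  exact: (step _ _ Mk IH1 (le_trans s0 Mk1)).
move=> Y; have [k hk] : exists k : nat, Y <= k%:R.
  by exists (Num.truncn Y).+1; rewrite ltW // truncnS_gt.
exists (n + k.*2)%N => m hm.
have le_n : (n <= m)%N by rewrite (leq_trans _ hm) // leq_addr.
have kj : (k <= (m - n)./2)%N.
  by rewrite -(doubleK k) half_leq // leq_subRL.
have Yj : Y <= ((m - n)./2)%:R by rewrite (le_trans hk) // ler_nat.
have : m = (odd (m - n) + (n + (m - n)./2.*2))%N.
  by rewrite addnCA odd_double_half subnKC.
have [l0 l1] := lin (m - n)./2.
by case: (odd _) => ->; rewrite ?add0n ?add1n; lra.
Qed.

End Weights.

(** * Trajectories on a vertical line *)

Lemma bernoulli {R : realType} (lam : R) k : 1 < lam ->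
  1 + k%:R * (lam - 1) <= lam ^+ k.
Proof.
move=> lam1; have l0 : 0 < lam - 1 by rewrite subr_gt0.
elim: k => [|k IH]; first by rewrite mul0r addr0 expr0.
rewrite exprS; apply: le_trans (ler_wpM2l _ IH); last by lra.
rewrite -natr1; have : 0 <= k%:R * (lam - 1) * (lam - 1).
  by rewrite !mulr_ge0 // ltW.
by lra.
Qed.

Lemma pow_unbounded {R : realType} (lam Y : R) : 1 < lam ->
  exists k, Y <= lam ^+ k.
Proof.
move=> lam1; have l0 : 0 < lam - 1 by rewrite subr_gt0.
exists (Num.truncn (Y / (lam - 1))).+1; apply: le_trans (bernoulli _ lam1).
have := truncnS_gt (Y / (lam - 1)); rewrite ltr_pdivrMr // => h.
by apply: ltW; apply: lt_le_trans h _; rewrite lerDr.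
Qed.

(** The trajectories starting on a vertical line of the quadrant, parametrised by
the logarithm of the second initial value, up to an additive constant. *)
Definition log_family {R : realType} (a1 a2 b1 b2 : R) (X : R -> nat -> R) :=
  [/\ forall s, solution a1 a2 b1 b2 (X s),
      forall s t, X s 0 = X t 0 &
      forall s t, ln (X t 1) - ln (X s 1) = t - s].

Section Family.
Context {R : realType}.
Variables (a1 a2 b1 b2 : R).
Hypotheses (a1_gt0 : 0 < a1) (a2_gt0 : 0 < a2).
Hypotheses (b1_gt1 : 1 < b1) (b2_gt1 : 1 < b2).
Notation wt := (weight a1 b1).
Notation fslope X s := (slope b1 b2 (wt (X s))).

Lemma weight_itv x : solution a1 a2 b1 b2 x -> forall n, 0 < wt x n < 1.
Proof.
move=> sx n.
by rewrite (weight_gt0 a1_gt0 a2_gt0 n sx) (weight_lt1 a1_gt0 a2_gt0 n sx).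
Qed.

(** Any number strictly between 1 and both exponents would serve. *)
Definition rate : R := (1 + Num.min b1 b2) / 2.

Lemma rate_gt1 : 1 < rate.
Proof.
have : 1 < Num.min b1 b2 by rewrite lt_min b1_gt1.
by rewrite /rate; lra.
Qed.

Lemma rate_lt : rate < b1 /\ rate < b2.
Proof.
have h : rate < Num.min b1 b2 by move: rate_gt1; rewrite /rate; lra.
by move: h; rewrite lt_min => /andP[].
Qed.

Let rate_le1 : rate <= b1. Proof. by rewrite ltW // rate_lt.1. Qed.
Let rate_le2 : rate <= b2. Proof. by rewrite ltW // rate_lt.2. Qed.

Section OneFamily.
Variable X : R -> nat -> R.
Hypothesis famX : log_family a1 a2 b1 b2 X.

Lemma family_solution s : solution a1 a2 b1 b2 (X s).
Proof. by case: famX. Qed.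

Lemma family_slope_gt0 s n : 0 < fslope X s n.+1.
Proof. by apply: slope_gt0 => //; exact/weight_itv/family_solution. Qed.

Lemma family_slope_ge0 s n : 0 <= fslope X s n.
Proof. by case: n => [//|n]; rewrite ltW // family_slope_gt0. Qed.

Lemma family_subgradient s t n :
  fslope X s n * (t - s) <= ln (X t n) - ln (X s n).
Proof.
have [sol e0 e1] := famX.
exact: (slope_subgradient a1_gt0 a2_gt0 b1_gt1 b2_gt1).
Qed.

Lemma family_mono s t n : s <= t -> ln (X s n) <= ln (X t n).
Proof.
move=> st; rewrite -subr_ge0; apply: le_trans (family_subgradient s t n).
by rewrite mulr_ge0 ?subr_ge0 // family_slope_ge0.
Qed.

Lemma family_slope_mono s t n : s <= t -> fslope X s n <= fslope X t n.
Proof. exact: subgradient_mono (fun s t => family_subgradient s t n) s t. Qed.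

Lemma family_slope_lower s n :
  Num.min 1 (fslope X s 2) <= fslope X s n.+1.
Proof.
have wi := weight_itv (family_solution s).
have c0 : 0 <= Num.min 1 (fslope X s 2).
  by rewrite le_min ler01 family_slope_ge0.
have c1 : Num.min 1 (fslope X s 2) <= fslope X s 1 by rewrite ge_min lexx.
have c2 : Num.min 1 (fslope X s 2) <= fslope X s 2 by rewrite ge_min lexx orbT.
have h k := slope_growth_pair rate_gt1 rate_le1 rate_le2 wi k c0 c1 c2.
have up k : Num.min 1 (fslope X s 2) <= rate ^+ k * Num.min 1 (fslope X s 2).
  by rewrite ler_peMl // exprn_ege1 // ltW // rate_gt1.
have [h1 h2] := h n./2; rewrite -[n]odd_double_half; case: (odd n).
  exact: le_trans (up _) h2.
exact: le_trans (up _) h1.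
Qed.

Lemma family_slope_unbounded s Y : exists n0, forall n, (n0 <= n)%N ->
  Y <= fslope X s n.
Proof.
have wi := weight_itv (family_solution s).
pose c := Num.min 1 (fslope X s 2).
have c0 : 0 < c by rewrite lt_min ltr01 family_slope_gt0.
have c1 : c <= fslope X s 1 by rewrite ge_min lexx.
have c2 : c <= fslope X s 2 by rewrite ge_min lexx orbT.
have h k := slope_growth_pair rate_gt1 rate_le1 rate_le2 wi k (ltW c0) c1 c2.
have [k hk] := pow_unbounded (Y / c) rate_gt1.
exists (k.*2).+1 => -[//|n]; rewrite ltnS => kn.
have Yk : Y <= rate ^+ n./2 * c.
  rewrite -ler_pdivrMr // (le_trans hk) // ler_weXn2l ?ltW ?rate_gt1 //.
  by rewrite -(doubleK k) half_leq.
have [h1 h2] := h n./2; rewrite -[n]odd_double_half; case: (odd n).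
  exact: le_trans Yk h2.
exact: le_trans Yk h1.
Qed.

(** The slopes tend to infinity, so the two trajectories drift apart. If the upper
one never reaches the upper trap, the lower one ends in the lower trap. Hence
at most one trajectory of a family neither escapes nor vanishes. *)
Lemma family_dichotomy s t : s < t -> escapes (X t) \/ vanishes (X s).
Proof.
move=> st.
have [M M0 hM] := trap_up b2 a1_gt0 a2_gt0 b1_gt1.
have [M' M'0 hM'] := trap_down a1_gt0 a2_gt0 b1_gt1 b2_gt1.
have [|noesc] := pselect (escapes (X t)); first by left.
right; have [n0 hn0] := family_slope_unbounded s ((M + M') / (t - s)).
have low n : (n0 <= n)%N -> ln (X s n.+1) <= - M'.
  move=> hn; have up : ln (X t n.+1) < M.
    rewrite ltNge; apply/negP => h; apply: noesc.
    exact: hM (family_solution t) h.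
  have := hn0 n.+1 (leqW hn); rewrite ler_pdivrMr ?subr_gt0 // => h.
  by have := family_subgradient s t n.+1; lra.
by apply: (hM' _ n0.+1 (family_solution s)); apply: low.
Qed.

End OneFamily.

(** The engine of the proof. By monotonicity in [s], all trajectories with
parameter in [[s0, s1]] are large, or all are small, from a common index on; so
the sign of [(b1 ^+ 2 - b2) * ln x] is the same for all of them, and one of the
two growth lemmas applies. The constants [kap] and [rate] depend on the
parameters of the recursion only; the initial index depends on the interval. *)
Lemma family_growth : exists2 kap : R, 0 < kap & forall X s0 s1,
  log_family a1 a2 b1 b2 X -> s0 <= s1 -> escapes (X s0) \/ vanishes (X s1) ->
  exists n1, forall s m k, s0 <= s <= s1 -> (n1 <= m)%N ->
    kap * rate ^+ k * fslope X s m <= fslope X s (m + k.*2).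
Proof.
have [pm pm0 hpm] := weight_lower b2 a1_gt0 a2_gt0 b1_gt1.
have [e [Y [e0 e1 e_lam halt]]] :=
  weight_alternation a1_gt0 a2_gt0 b1_gt1 b2_gt1 rate_lt.2.
pose th : R := (1 - e) / (1 - e / 2).
have th0 : 0 < th by rewrite /th divr_gt0 //; lra.
have th1 : th < 1 by rewrite /th ltr_pdivrMr; lra.
pose kap1 := Num.min 1 (pm * b1).
pose kap2 := Num.min 1 (e * b1 / (b1 / (1 - th) + 1)).
have b10 : 0 < b1 := lt_trans ltr01 b1_gt1.
have kap1_gt0 : 0 < kap1 by rewrite lt_min ltr01 mulr_gt0.
have kap2_gt0 : 0 < kap2.
  rewrite lt_min ltr01 divr_gt0 ?mulr_gt0 // addr_gt0 // divr_gt0 //.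
  by rewrite subr_gt0.
exists (Num.min kap1 kap2); first by rewrite lt_min kap1_gt0.
move=> X s0 s1 famX s01 esc.
have rate0 : 0 < rate := lt_trans ltr01 rate_gt1.
have weaken kap s m n k : Num.min kap1 kap2 <= kap ->
    kap * rate ^+ k * fslope X s m <= fslope X s n ->
    Num.min kap1 kap2 * rate ^+ k * fslope X s m <= fslope X s n.
  move=> hk; apply: le_trans; rewrite ler_wpM2r ?family_slope_ge0 //.
  by rewrite ler_pM2r ?exprn_gt0.
pose del := b1 ^+ 2 - b2.
have [n0 [sgn hn0]] : exists n0 (sgn : bool), forall s, s0 <= s <= s1 ->
    forall n, (n0 <= n)%N ->
    if sgn then 0 <= del * ln (X s n) else del * ln (X s n) <= - Y.
  have [del0|del0|del0] := ltgtP del 0; last first.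
  - by exists 0%N, true => s _ n _; rewrite del0 mul0r.
  - case: esc => hesc.
      have [n0 h] := hesc 0; exists n0, true => s /andP[hs0 hs1] n hn.
      by rewrite mulr_ge0 ?(ltW del0) // (le_trans (h n hn)) // family_mono.
    have [n0 h] := hesc (Y / del); exists n0, false => s /andP[hs0 hs1] n hn.
    rewrite mulrC -ler_pdivlMr // mulNr (le_trans _ (h n hn)) //.
    exact: family_mono.
  case: esc => hesc.
    have [n0 h] := hesc (Y / - del); exists n0, false => s /andP[hs0 hs1] n hn.
    have h1 := le_trans (h n hn) (family_mono famX n hs0).
    by move: h1; rewrite ler_pdivrMr ?oppr_gt0 //; lra.
  have [n0 h] := hesc 0; exists n0, true => s /andP[hs0 hs1] n hn.
  have h1 := le_trans (family_mono famX n hs1) (h n hn).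
  by rewrite -mulrNN mulr_ge0 ?oppr_ge0 ?(ltW del0) //; lra.
case: sgn hn0 => hn0.
  exists n0.+2 => s m k hs hm; apply: (weaken kap1); first by rewrite ge_min lexx.
  have sx := family_solution famX s.
  apply: (@slope_growth_mixed _ b1 b2 rate _ b1_gt1 b2_gt1 rate_gt1 rate_le1
    rate_le2 _ pm n0.+1) => //.
  - exact: weight_itv.
  case=> // n hn; apply: hpm => //; apply: hn0 => //.
  by rewrite ltnW.
(* By monotonicity in [s], [S] bounds the initial ratios on the whole interval. *)
pose S := Num.max (fslope X s1 n0.+2 / fslope X s0 n0.+1)
                  (fslope X s1 n0.+3 / fslope X s0 n0.+2).
have S0 : 0 <= S.
  by rewrite le_max divr_ge0 // family_slope_ge0.
have [j0 hj0] : exists j, th ^+ j * S <= 1.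
  have thV : 1 < th^-1 by rewrite invf_gt1.
  have [j hj] := pow_unbounded S thV.
  exists j; rewrite mulrC -ler_pdivlMr ?exprn_gt0 // div1r.
  by rewrite -exprVn.
have start s i n : s0 <= s <= s1 ->
    fslope X s1 n.+2 / fslope X s0 n.+1 <= S ->
    fslope X s n.+2 <= S * fslope X s n.+1.
  move=> /andP[hs0 hs1]; rewrite ler_pdivrMr ?family_slope_gt0 // => hS.
  apply: le_trans (family_slope_mono famX _ hs1) _; apply: (le_trans hS).
  by rewrite ler_wpM2l // family_slope_mono.
exists (n0 + j0.*2).+2 => s m k hs hm; apply: (weaken kap2).
  by rewrite ge_min lexx orbT.
case: m hm => // -[//|m]; rewrite !ltnS => hm.
have sx := family_solution famX s.
have [hl ll] := halt _ n0 sx (fun n hn => hn0 s hs n hn).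
apply: (@slope_growth_alternating _ b1 b2 rate _ b1_gt1 b2_gt1 rate_gt1 _ e S n0
  _ _ _ _ _ j0) => //.
- exact: weight_itv.
- by apply: start => //; rewrite le_max lexx.
- by apply: start => //; rewrite le_max lexx orbT.
Qed.

End Family.

(** * Convex functions modulo one *)

Section Mass.
Context {R : realType}.
Notation mu := (@lebesgue_measure R).
Implicit Types (A B : set (measurableTypeR R)) (s t u : R).

Definition mass A s t : R := fine (mu (A `&` `[s, t[)).

Lemma mass_fin A s t : measurable A -> mu (A `&` `[s, t[) \is a fin_num.
Proof.
move=> mA; rewrite ge0_fin_numE; last exact: measure_ge0.
apply: (@le_lt_trans _ _ (mu `[s, t[)%E).
  apply: le_measure; rewrite ?inE //; first exact: measurableI.
rewrite lebesgue_measure_itv /=; case: ifP => _; last exact: ltry.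
by rewrite -EFinB ltry.
Qed.

Lemma mass_ge0 A s t : 0 <= mass A s t.
Proof. by rewrite /mass fine_ge0 // measure_ge0. Qed.

Lemma mass_ext A B s t : (forall x, s <= x < t -> A x <-> B x) ->
  mass A s t = mass B s t.
Proof.
move=> h; rewrite /mass; congr (fine (mu _)); apply/seteqP.
split=> x [Ax xst]; split=> //; move: (xst); rewrite /= in_itv /= => /h [AB BA].
  exact: AB.
exact: BA.
Qed.

Lemma mass_full s t : s <= t -> mass setT s t = t - s.
Proof.
move=> st; rewrite /mass setTI lebesgue_measure_itv /= lte_fin.
by move: st; rewrite le_eqVlt => /predU1P[->|->]; rewrite ?ltxx ?subrr.
Qed.

Lemma mass_empty s t : mass set0 s t = 0.
Proof. by rewrite /mass set0I measure0. Qed.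

Lemma mass_split A s u t : measurable A -> s <= u -> u <= t ->
  mass A s t = mass A s u + mass A u t.
Proof.
move=> mA su ut; rewrite /mass -fineD ?mass_fin //; congr fine.
rewrite -measureU //; first last.
- apply/seteqP; split => // x [[_ /=] + [_ /=]]; rewrite !in_itv /=.
  by move=> /andP[_ h1] /andP[h2 _]; move: (lt_le_trans h1 h2); rewrite ltxx.
- exact: measurableI.
- exact: measurableI.
congr (mu _); rewrite -setIUr; congr (_ `&` _); apply/seteqP; split=> x /=.
  rewrite !in_itv /= => /andP[sx xt].
  by case: (ltP x u) => xu; [left|right]; rewrite ?sx ?xt ?xu.
rewrite !in_itv /= => -[] /andP[h1 h2]; apply/andP; split=> //.
  exact: lt_le_trans ut.
exact: le_trans h1.
Qed.

Lemma mass_compl A s t : measurable A -> s <= t ->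
  mass (~` A) s t = (t - s) - mass A s t.
Proof.
move=> mA st; rewrite -(mass_full st); apply/esym/eqP; rewrite subr_eq; apply/eqP.
have mAC : measurable (~` A) by exact: measurableC.
rewrite /mass -fineD ?mass_fin //; congr fine.
rewrite -measureU //; first by congr (mu _); rewrite -setIUl setUCl.
- exact: measurableI.
- exact: measurableI.
- by apply/seteqP; split => // x [[/= h _] [/= h' _]].
Qed.

End Mass.

Definition fpart {R : realType} (t : R) : R := t - (Num.floor t)%:~R.

Lemma fpart_itv {R : realType} (t : R) : 0 <= fpart t < 1.
Proof. by have := floor_itv t; rewrite /fpart intrD; lra. Qed.

Lemma fpartE {R : realType} (k : int) (t : R) : k%:~R <= t < k%:~R + 1 ->
  fpart t = t - k%:~R.
Proof. by move=> h; rewrite /fpart (@floor_def _ _ k) // intrD. Qed.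

Lemma fpart_shift {R : realType} (a t : R) : 0 < a < 1 ->
  (fpart (t - a) < 1 - a) = ~~ (fpart t < a).
Proof.
move=> /andP[a0 a1]; have := fpart_itv t; set k := Num.floor t.
have -> : fpart t = t - k%:~R by [].
move=> ht; case: (ltP (t - k%:~R) a) => h /=.
  rewrite (@fpartE _ (k - 1)) ?intrB //; last by lra.
  by apply/negbTE; rewrite -leNgt; lra.
by rewrite (@fpartE _ k) //; lra.
Qed.

(** A strictly increasing convex function, given with a subgradient. *)
Definition chart {R : realType} (f d : R -> R) : Prop :=
  [/\ continuous f, forall s, 0 < d s &
      forall s t, d s * (t - s) <= f t - f s].

Definition window {R : realType} (a : R) (f : R -> R) :
  set (measurableTypeR R) := [set s | fpart (f s) < a].

Lemma measurable_fpart {R : realType} : measurable_fun setT (@fpart R).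
Proof.
apply: measurable_funB => //; apply: nondecreasing_measurable => // s t st.
by rewrite ler_int floor_ge_int (le_trans (floor_le s)).
Qed.

Section Window.
Context {R : realType}.
Implicit Types (f d : R -> R) (a s t : R).

Lemma measurable_window a f : continuous f -> measurable (window a f).
Proof.
move=> cf; have mf : measurable_fun setT (@fpart R \o f).
  apply: measurableT_comp; first exact: measurable_fpart.
  exact: continuous_measurable_fun.
rewrite -[window a f]setTI -[window a f]/((fun s => fpart (f s) < a) @^-1` [set true]).
by apply: (measurable_fun_ltr mf) => //; exact: measurable_cst.
Qed.

Lemma chart_shift f d c : chart f d -> chart (fun s => f s - c) d.
Proof.
case=> cf d0 sub; split=> //.
  by move=> s; apply: cvgB; [exact: cf|exact: cvg_cst].
move=> s t; apply: le_trans (sub s t) _; lra.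
Qed.

Lemma chart_lt f d s t : chart f d -> s < t -> f s < f t.
Proof.
case=> _ d0 sub st; rewrite -subr_gt0; apply: lt_le_trans (sub s t).
by rewrite mulr_gt0 ?subr_gt0.
Qed.

Lemma chart_le f d s t : chart f d -> s <= t -> f s <= f t.
Proof.
by move=> cf; rewrite le_eqVlt => /predU1P[->//|/(chart_lt cf)/ltW].
Qed.

Lemma chart_slope_le f d s t : chart f d -> s <= t -> d s <= d t.
Proof. by case=> _ _ sub; exact: (subgradient_mono sub). Qed.

Lemma chart_ivt f d s t v : chart f d -> s <= t -> f s <= v <= f t ->
  exists2 u, s <= u <= t & f u = v.
Proof.
move=> [cf _ _ ] st hv.
have fst : f s <= f t by case/andP: hv => h1 h2; exact: le_trans h2.
have cst : {within `[s, t], continuous f} by exact: continuous_subspaceT.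
have hm : Num.min (f s) (f t) <= v <= Num.max (f s) (f t) by rewrite min_l // max_r.
by have [u] := IVT st cst hm; rewrite in_itv /= => h <-; exists u.
Qed.

Lemma chart_lt_inv f d s t : chart f d -> f s < f t -> s < t.
Proof.
move=> cf h; rewrite ltNge; apply/negP => /(chart_le cf).
by rewrite leNgt h.
Qed.


(** On one period of [f] the window comes first, and there a convex function is
slowest: the window occupies at least its share. *)
Lemma mass_window_period f d a s t (k : int) : chart f d -> 0 < a < 1 ->
  s <= t -> f s = k%:~R -> f t <= k%:~R + 1 ->
  a * (t - s) <= mass (window a f) s t.
Proof.
move=> cf /andP[a0 a1] st fs ft; have [contf d0 sub] := cf.
have mW : measurable (window a f) := measurable_window a contf.
have inW x : s <= x < t -> fpart (f x) = f x - k%:~R.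
  move=> /andP[sx xt]; apply: fpartE; rewrite -fs (chart_le cf) //=.
  by rewrite fs; apply: lt_le_trans (chart_lt cf xt) ft.
have [ftle|ftgt] := leP (f t) (k%:~R + a).
  rewrite (@mass_ext _ _ setT) ?mass_full //; last first.
    move=> x xst; split=> // _; rewrite /window /= inW //.
    case/andP: xst => _ xt; have := lt_le_trans (chart_lt cf xt) ftle.
    by lra.
  by rewrite ler_piMl ?subr_ge0 // ltW.
have [|u /andP[su ut] fu] := chart_ivt (v := k%:~R + a) cf st.
  by rewrite fs lerDl (ltW a0) /= ltW.
have hm : mass (window a f) s t >= u - s.
  rewrite (mass_split mW su ut) -(mass_full su) (@mass_ext _ setT (window a f)).
    by rewrite lerDl mass_ge0.
  move=> x /andP[sx xu]; split=> // _; rewrite /window /= inW; last first.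
    by rewrite sx (lt_le_trans xu).
  by have := chart_lt cf xu; rewrite fu; lra.
apply: le_trans hm.
have h1 : a <= d u * (u - s) by have := sub u s; rewrite fu fs; lra.
have h2 : d u * (t - u) <= 1 - a by have := sub u t; rewrite fu; lra.
have h3 : a * (t - u) <= (1 - a) * (u - s).
  rewrite -(ler_pM2l (d0 u)) (mulrCA _ a) (mulrCA _ (1 - a)).
  apply: (@le_trans _ _ (a * (1 - a))).
    by rewrite ler_pM2l.
  by rewrite mulrC ler_pM2l ?subr_gt0.
by move: h3; lra.
Qed.

Lemma mass_window_int f d a s t (k : int) : chart f d -> 0 < a < 1 ->
  s <= t -> f s = k%:~R -> a * (t - s) <= mass (window a f) s t.
Proof.
move=> cf a01 st fs; have [contf d0 sub] := cf.
have mW : measurable (window a f) := measurable_window a contf.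
have [n hn] : exists n : nat, f t - f s <= n%:R.
  by exists (Num.truncn (f t - f s)).+1; rewrite ltW // truncnS_gt.
elim: n s k st fs hn => [|n IH] s k st fs hn.
  by apply: (mass_window_period cf a01 st fs); rewrite -fs; lra.
have [ftle|ftgt] := leP (f t) (k%:~R + 1).
  exact: mass_window_period cf a01 st fs ftle.
have [|u /andP[su ut] fu] := chart_ivt (v := k%:~R + 1) cf st.
  by rewrite fs lerDl ler01 /= ltW.
have fu' : f u = (k + 1)%:~R by rewrite fu intrD.
rewrite (mass_split mW su ut).
have -> : a * (t - s) = a * (u - s) + a * (t - u) by ring.
apply: lerD; first by apply: (mass_window_period cf a01 su fs); rewrite fu.
by apply: (IH u _ ut fu'); move: hn; rewrite fu fs -natr1; lra.
Qed.

(** Complete periods do not lose mass; the incomplete first one is no longer than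
the inverse slope at its left end. *)
Lemma mass_window_lower f d a s t : chart f d -> 0 < a < 1 -> s <= t ->
  a * (t - s) - (d s)^-1 <= mass (window a f) s t.
Proof.
move=> cf a01 st; have [contf d0 sub] := cf; have /andP[a0 a1] := a01.
have mW : measurable (window a f) := measurable_window a contf.
pose k := Num.floor (f s) + 1.
have ks : f s < k%:~R by have := floor_itv (f s); case/andP.
have sk : k%:~R <= f s + 1.
  by have := floor_itv (f s); rewrite /k intrD => /andP[]; lra.
have short u : s <= u -> f u <= k%:~R -> a * (u - s) <= (d s)^-1.
  move=> su fu; apply: (@le_trans _ _ (u - s)).
    by rewrite ler_piMl ?subr_ge0 // ltW.
  rewrite -div1r ler_pdivlMr // mulrC; have := sub s u; lra.
have [ftk|ftk] := leP (f t) k%:~R.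
  have := short t st ftk; have := mass_ge0 (window a f) s t; lra.
have [|u /andP[su ut] fu] := chart_ivt (v := k%:~R) cf st.
  by rewrite (ltW ks) (ltW ftk).
rewrite (mass_split mW su ut).
have h1 : a * (u - s) <= (d s)^-1 by apply: short su _; rewrite fu.
have h2 := mass_window_int cf a01 ut fu.
have h3 := mass_ge0 (window a f) s u.
have -> : a * (t - s) = a * (u - s) + a * (t - u) by ring.
by lra.
Qed.

(** The upper bound is the lower bound for the complementary window, which is a
window of [f - a]. *)
Lemma mass_window f d a s t : chart f d -> 0 < a < 1 -> s <= t ->
  `|mass (window a f) s t - a * (t - s)| <= (d s)^-1.
Proof.
move=> cf a01 st; have /andP[a0 a1] := a01.
have [contf _ _] := cf.
have h1 := mass_window_lower cf a01 st.
have a01' : 0 < 1 - a < 1 by apply/andP; split; lra.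
have h2 := mass_window_lower (chart_shift a cf) a01' st.
have e : mass (window (1 - a) (fun s => f s - a)) s t = mass (~` window a f) s t.
  by apply: mass_ext => x _; rewrite /window /= fpart_shift //; split=> /negP.
move: h2; rewrite e mass_compl //; last exact: measurable_window.
by rewrite ler_norml => h2; apply/andP; split; move: h1 h2; lra.
Qed.

(** One-sided covariance of the two windows: it differs from their covariance by
[a] times the quantity bounded in [mass_window]. *)
Definition covar a f g s t := mass (window a f `&` window a g) s t
  - a * mass (window a g) s t.

Lemma covar_split a f g s u t : continuous f -> continuous g ->
  s <= u -> u <= t -> covar a f g s t = covar a f g s u + covar a f g u t.
Proof.
move=> cf cg su ut.
have mf : measurable (window a f) := measurable_window a cf.
have mg : measurable (window a g) := measurable_window a cg.
rewrite /covar (mass_split mg su ut) (mass_split _ su ut); first by ring.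
exact: measurableI.
Qed.

(** Within one period of [g] the set [window a g] is an interval, so [mass_window]
applies to it. *)
Lemma covar_period a f d g e s t (k : int) : chart f d -> chart g e ->
  0 < a < 1 -> s <= t -> k%:~R <= g s -> g t <= k%:~R + 1 ->
  `|covar a f g s t| <= (d s)^-1.
Proof.
move=> cf cg a01 st gs gt; have /andP[a0 a1] := a01.
have [contf df0 _] := cf; have [contg de0 _] := cg.
have inW x : s <= x < t -> fpart (g x) = g x - k%:~R.
  move=> /andP[sx xt]; apply: fpartE; rewrite (le_trans gs) ?(chart_le cg) //=.
  by apply: lt_le_trans (chart_lt cg xt) gt.
have d0 : 0 <= (d s)^-1 by rewrite invr_ge0 ltW.
have empty u : s <= u -> u <= t -> k%:~R + a <= g u -> covar a f g u t = 0.
  move=> su ut gu; rewrite /covar (@mass_ext _ _ set0) ?mass_empty.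
    rewrite (@mass_ext _ _ set0) ?mass_empty ?mulr0 ?subrr //.
    move=> x /andP[ux xt]; split=> //; rewrite /window /= inW.
      by have := chart_le cg ux; lra.
    by rewrite (le_trans su).
  move=> x /andP[ux xt]; split=> // -[_]; rewrite /window /= inW.
    by have := chart_le cg ux; lra.
  by rewrite (le_trans su).
have full u : s <= u -> u <= t -> g u <= k%:~R + a ->
    `|covar a f g s u| <= (d s)^-1.
  move=> su ut gu.
  have gW x : s <= x < u -> window a g x.
    move=> /andP[sx xu]; rewrite /window /= inW ?sx ?(lt_le_trans xu) //.
    by have := chart_lt cg xu; lra.
  rewrite /covar (@mass_ext _ _ (window a f)); last first.
    by move=> x hx; split=> [[]//|fx]; split=> //; apply: gW.
  rewrite (@mass_ext _ (window a g) setT); last by move=> x hx; split=> // _; exact: gW.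
  by rewrite mass_full //; apply: mass_window.
have [gta|gta] := leP (g t) (k%:~R + a); first exact: full.
have [gsa|gsa] := leP (g s) (k%:~R + a); last first.
  by rewrite empty // ?normr0 // ltW.
have [|u /andP[su ut] gu] := chart_ivt (v := k%:~R + a) cg st.
  by rewrite gsa ltW.
rewrite (covar_split _ contf contg su ut) (empty u) ?gu // addr0.
by apply: full => //; rewrite gu.
Qed.

(** Sum of [covar_period] over the periods of [g]. The function [f] is [c] times
steeper than [g], and by convexity the inverse slope of [g] at the beginning of
a period is at most the length of the period before: the errors add up to a
length divided by [c]. *)
Lemma covar_int a f d g e s t (k : int) (c : R) : chart f d -> chart g e ->
  0 < a < 1 -> 0 < c -> s <= t ->
  (forall x, s <= x <= t -> c * e x <= d x) -> g s = k%:~R ->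
  `|covar a f g s t| <= ((e s)^-1 + (t - s)) / c.
Proof.
move=> cf cg a01 c0 st ced gs.
have [contf df0 _] := cf; have [contg de0 sub] := cg.
have dinv x : s <= x <= t -> (d x)^-1 <= (e x)^-1 / c.
  by move=> hx; rewrite -invfM lef_pV2 ?posrE ?mulr_gt0 // mulrC ced.
have [n hn] : exists n : nat, g t - g s <= n%:R.
  by exists (Num.truncn (g t - g s)).+1; rewrite ltW // truncnS_gt.
have small u v (j : int) : s <= u -> u <= v -> v <= t -> g u = j%:~R ->
    g v <= j%:~R + 1 -> `|covar a f g u v| <= (e u)^-1 / c.
  move=> su uv vt gu gv; apply: le_trans (dinv u _); last by rewrite su (le_trans uv).
  by apply: (@covar_period _ _ _ _ _ _ _ j cf cg) => //; rewrite gu.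
have wk u v : u <= v -> (e u)^-1 / c <= ((e u)^-1 + (v - u)) / c.
  by move=> uv; rewrite ler_pM2r ?invr_gt0 // lerDl subr_ge0.
suff main u (j : int) : s <= u -> u <= t -> g u = j%:~R -> g t - g u <= n%:R ->
    `|covar a f g u t| <= ((e u)^-1 + (t - u)) / c by exact: (main s k).
elim: n u j {hn} => [|n IH] u j su ut gu hn.
  apply: le_trans (wk u t ut).
  by apply: (small _ _ j) => //; rewrite -gu; move: hn; rewrite mulr0n; lra.
have [gtle|gtgt] := leP (g t) (j%:~R + 1).
  by apply: le_trans (wk u t ut); apply: small gu gtle.
have [|v /andP[uv vt] gv] := chart_ivt (v := j%:~R + 1) cg ut.
  by rewrite gu lerDl ler01 /= ltW.
have gv' : g v = (j + 1)%:~R by rewrite gv intrD.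
rewrite (covar_split _ contf contg uv vt); apply: (le_trans (ler_normD _ _)).
have h1 : `|covar a f g u v| <= (e u)^-1 / c.
  by apply: (small _ _ j) => //; rewrite gv.
have h2 : `|covar a f g v t| <= ((e v)^-1 + (t - v)) / c.
  apply: (IH v _ _ vt gv'); first exact: le_trans uv.
  by move: hn; rewrite gv gu -natr1; lra.
have h3 : (e v)^-1 <= v - u.
  rewrite -div1r ler_pdivrMr // mulrC.
  by have := sub v u; rewrite gv gu; lra.
apply: (le_trans (lerD h1 h2)); rewrite -mulrDl ler_pM2r ?invr_gt0 //.
by lra.
Qed.

(** The incomplete first period of [g] costs one more inverse slope. *)
Lemma covar_bound a f d g e s t (c : R) : chart f d -> chart g e ->
  0 < a < 1 -> 0 < c -> s <= t ->
  (forall x, s <= x <= t -> c * e x <= d x) ->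
  `|covar a f g s t| <= (2 * (e s)^-1 + (t - s)) / c.
Proof.
move=> cf cg a01 c0 st ced.
have [contf df0 _] := cf; have [contg de0 sub] := cg.
have dinv : (d s)^-1 <= (e s)^-1 / c.
  by rewrite -invfM lef_pV2 ?posrE ?mulr_gt0 // mulrC ced // lexx.
pose k := Num.floor (g s).
have [ks sk] : k%:~R <= g s /\ g s < k%:~R + 1.
  by have := floor_itv (g s); rewrite intrD => /andP[].
have e0 : 0 < (e s)^-1 by rewrite invr_gt0.
have [gtle|gtgt] := leP (g t) (k%:~R + 1).
  apply: le_trans (covar_period cf cg a01 st ks gtle) _; apply: (le_trans dinv).
  by rewrite ler_pM2r ?invr_gt0 //; lra.
have [|v /andP[sv vt] gv] := chart_ivt (v := k%:~R + 1) cg st.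
  by rewrite !ltW.
have gv' : g v = (k + 1)%:~R by rewrite gv intrD.
rewrite (covar_split _ contf contg sv vt); apply: (le_trans (ler_normD _ _)).
have gv1 : g v <= k%:~R + 1 by rewrite gv.
have h1 := covar_period cf cg a01 sv ks gv1.
have h2 : `|covar a f g v t| <= ((e v)^-1 + (t - v)) / c.
  apply: (covar_int cf cg a01 c0 vt _ gv') => x /andP[vx xt].
  by apply: ced; rewrite xt (le_trans sv).
have h3 : (e v)^-1 <= (e s)^-1.
  by rewrite lef_pV2 ?posrE // (chart_slope_le cg).
apply: (le_trans (lerD (le_trans h1 dinv) h2)).
by rewrite -mulrDl ler_pM2r ?invr_gt0 //; lra.
Qed.

End Window.

(** * Cesaro means *)

Definition cesaro0 {R : realType} (u : nat -> R) : Prop :=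
  forall e : R, 0 < e -> exists N0, forall N, (N0 <= N)%N ->
    `|\sum_(j < N) u j| <= e * N%:R.

Lemma exists_nat_ge {R : realType} (x : R) : exists n : nat, x <= n%:R.
Proof. by exists (Num.truncn x).+1; rewrite ltW // truncnS_gt. Qed.

Section Cesaro.
Context {R : realType}.
Implicit Types (u : nat -> R).

Lemma sum_bounded u m n : (forall j, `|u j| <= 1) ->
  `|\sum_(m <= j < n) u j| <= (n - m)%:R.
Proof.
move=> u1; apply: le_trans (ler_norm_sum _ _ _) _.
apply: le_trans (ler_sum _ (fun j _ => u1 j)) _.
by rewrite sumr_const_nat.
Qed.

Lemma cesaro0_shift u n1 : (forall j, `|u j| <= 1) ->
  cesaro0 (fun j => u (n1 + j)%N) -> cesaro0 u.
Proof.
move=> u1 h e e0; have e2 : 0 < e / 2 by rewrite divr_gt0.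
have [N0 hN0] := h _ e2; have [N1 hN1] := exists_nat_ge (n1%:R / (e / 2)).
exists (n1 + N0 + N1)%N => N hN.
have n1N : (n1 <= N)%N by rewrite (leq_trans _ hN) // -addnA leq_addr.
rewrite -(big_mkord xpredT u) (big_cat_nat (n := n1)) //=.
apply: le_trans (ler_normD _ _) _.
have -> : e * N%:R = e / 2 * N%:R + e / 2 * N%:R by field.
apply: lerD.
  apply: le_trans (sum_bounded _ _ u1) _; rewrite subn0 mulrC -ler_pdivrMr //.
  apply: (le_trans hN1); rewrite ler_nat (leq_trans _ hN) // leq_addl //.
rewrite -{1}(add0n n1) big_addn big_mkord.
under eq_bigr do rewrite addnC.
apply: le_trans (hN0 _ _) _; first by rewrite leq_subRL // (leq_trans _ hN) ?leq_addr.
by rewrite ler_pM2l // ler_nat leq_subr.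
Qed.

Lemma sum_parity u N : \sum_(j < N) u j =
  \sum_(j < uphalf N) u j.*2 + \sum_(j < N./2) u j.*2.+1.
Proof.
elim: N => [|N IH]; first by rewrite !big_ord0 addr0.
rewrite big_ord_recr IH /= uphalf_half.
case oN: (odd N); rewrite ?add1n ?add0n.
  rewrite -addrA; congr (_ + _); rewrite big_ord_recr /=; congr (_ + u _).
  by rewrite -{1}(odd_double_half N) oN add1n.
rewrite addrAC; congr (_ + _); rewrite big_ord_recr /=; congr (_ + u _).
by rewrite -{1}(odd_double_half N) oN add0n.
Qed.

Lemma cesaro0_parity u : cesaro0 (fun j => u j.*2) ->
  cesaro0 (fun j => u j.*2.+1) -> cesaro0 u.
Proof.
move=> h0 h1 e e0; have e2 : 0 < e / 2 by rewrite divr_gt0.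
have [N0 hN0] := h0 _ e2; have [N1 hN1] := h1 _ e2.
exists (N0 + N1)%N.*2.+1 => N hN; rewrite sum_parity.
have hN' : (N0 + N1 <= N./2)%N by rewrite -(doubleK (N0 + N1)%N) half_leq // ltnW.
have hup : (N0 <= uphalf N)%N.
  by rewrite uphalf_half (leq_trans _ (leq_addl _ _)) // (leq_trans _ hN') // leq_addr.
have hlo : (N1 <= N./2)%N by rewrite (leq_trans _ hN') // leq_addl.
apply: le_trans (ler_normD _ _) _.
apply: le_trans (lerD (hN0 _ hup) (hN1 _ hlo)) _.
rewrite -mulrDr -natrD -mulrA ler_pM2l //.
have : (uphalf N + N./2 = N)%N by rewrite uphalf_half -addnA addnn odd_double_half.
by move=> ->; rewrite mulrC ler_pdivrMr // ler_peMr // ler1n.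
Qed.

Lemma square_between N : (0 < N)%N ->
  exists n, (n.+1 ^ 2 <= N < n.+2 ^ 2)%N.
Proof.
elim: N => // -[|N] IH _; first by exists 0%N.
have [n /andP[n1 n2]] := IH isT.
have [h|h] := ltnP N.+2 (n.+2 ^ 2); first by exists n; rewrite h (leq_trans n1).
exists n.+1; rewrite h /=; apply: leq_ltn_trans n2 _.
by rewrite ltn_exp2r.
Qed.

(** Between two consecutive squares the partial sums move by at most the gap, which
is negligible against the squares themselves. *)
Lemma cesaro0_squares u : (forall j, `|u j| <= 1) ->
  (forall q : nat, exists n0, forall n, (n0 <= n)%N ->
    `|\sum_(j < n.+1 ^ 2) u j| < (n.+1 ^ 2)%:R / q.+1%:R) -> cesaro0 u.
Proof.
move=> u1 h e e0.
have [q hq] := exists_nat_ge (2 / e).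
have [n0 hn0] := h q.
have [p hp] := exists_nat_ge (6 / e).
exists ((n0 + p).+2 ^ 2)%N => N hN.
have N_gt0 : (0 < N)%N by rewrite (leq_trans _ hN) // expn_gt0.
have [n /andP[nN Nn]] := square_between N_gt0.
have npn : (n0 + p <= n)%N.
  have := leq_ltn_trans hN Nn; rewrite ltn_exp2r // !ltnS => h'.
  by rewrite ltnW.
rewrite -(big_mkord xpredT u) (big_cat_nat (n := (n.+1 ^ 2)%N)) //=.
apply: le_trans (ler_normD _ _) _; rewrite big_mkord.
have -> : e * N%:R = e / 2 * N%:R + e / 2 * N%:R by field.
apply: lerD.
  apply: le_trans (ltW (hn0 _ _)) _; first by rewrite (leq_trans _ npn) // leq_addr.
  rewrite mulrC; apply: ler_pM; rewrite ?ler_nat //.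
  rewrite -[e / 2]invrK lef_pV2 ?posrE ?invr_gt0 ?divr_gt0 //.
  by rewrite invf_div (le_trans hq) // ler_nat.
apply: le_trans (sum_bounded _ _ u1) _.
apply: (@le_trans _ _ (3 * n.+1%:R)).
  rewrite -natrM ler_nat leq_subLR.
  apply: leq_trans (ltnW Nn) _; rewrite -!mulnn; lia.
apply: (@le_trans _ _ (e / 2 * (n.+1 ^ 2)%:R)); last first.
  by rewrite ler_pM2l ?divr_gt0 // ler_nat.
rewrite -mulnn natrM mulrA ler_pM2r ?ltr0n //.
have : p%:R <= n.+1%:R :> R.
  by rewrite ler_nat (leq_trans (leq_addl n0 p)) // (leq_trans npn).
move=> hpn; have := le_trans hp hpn.
by rewrite ler_pdivrMr //; lra.
Qed.

End Cesaro.

(** * A law of large numbers under decaying correlations *)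

Section SecondMoment.
Context {R : realType}.
Variables (s0 s1 : R).
Hypothesis s01 : s0 <= s1.
Notation mu := (@lebesgue_measure R).
Notation J := (`[s0, s1[%classic : set (measurableTypeR R)).
Notation rfun := (measurableTypeR R -> R).

Definition bounded_mfun (f : rfun) : Prop :=
  measurable_fun setT f /\ exists M, forall x, `|f x| <= M.

Lemma bounded_mfun_cst c : bounded_mfun (fun=> c).
Proof. by split; [exact: measurable_cst | exists `|c|]. Qed.

Lemma bounded_mfunD f g : bounded_mfun f -> bounded_mfun g ->
  bounded_mfun (fun x => f x + g x).
Proof.
move=> [mf [M hM]] [mg [N hN]]; split; first exact: measurable_funD.
by exists (M + N) => x; apply: le_trans (ler_normD _ _) _; apply: lerD.
Qed.

Lemma bounded_mfunM f g : bounded_mfun f -> bounded_mfun g ->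
  bounded_mfun (fun x => f x * g x).
Proof.
move=> [mf [M hM]] [mg [N hN]]; split; first exact: measurable_funM.
by exists (M * N) => x; rewrite normrM; apply: ler_pM.
Qed.

Lemma bounded_mfun_sum (g : nat -> rfun) N : (forall j, bounded_mfun (g j)) ->
  bounded_mfun (fun x => \sum_(j < N) g j x).
Proof.
move=> hg; elim: N => [|N IH].
  by under eq_fun do rewrite big_ord0; exact: bounded_mfun_cst.
by under eq_fun do rewrite big_ord_recr /=; exact: bounded_mfunD.
Qed.

Lemma bounded_mfun_indic (A : set (measurableTypeR R)) : measurable A ->
  bounded_mfun (\1_A).
Proof.
move=> mA; split; first exact: measurable_indic.
by exists 1 => x; rewrite indicE; case: (_ \in _); rewrite ?normr1 ?normr0.
Qed.

Let muJ : mu J = (s1 - s0)%:E.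
Proof.
rewrite lebesgue_measure_itv /= lte_fin.
by move: s01; rewrite le_eqVlt => /predU1P[->|->]; rewrite ?ltxx ?subrr.
Qed.

Let muJ_fin : (mu J < +oo)%E.
Proof. by rewrite muJ ltry. Qed.

Lemma bounded_mfun_integrable f : bounded_mfun f -> mu.-integrable J (EFin \o f).
Proof.
move=> [mf [M hM]]; apply: measurable_bounded_integrable => //.
- exact: measurable_funTS.
exists M; split; first exact: num_real.
by move=> y My x _ /=; rewrite (le_trans (hM x)) // ltW.
Qed.

Definition mean (f : rfun) : R := \int[mu]_(x in J) f x.

Lemma meanD f g : bounded_mfun f -> bounded_mfun g ->
  mean (fun x => f x + g x) = mean f + mean g.
Proof. by move=> hf hg; rewrite /mean RintegralD //; exact: bounded_mfun_integrable. Qed.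

Lemma meanZ c f : bounded_mfun f -> mean (fun x => c * f x) = c * mean f.
Proof. by move=> hf; rewrite /mean RintegralZl //; exact: bounded_mfun_integrable. Qed.

Lemma mean_cst c : mean (fun=> c) = c * (s1 - s0).
Proof. by rewrite /mean Rintegral_cst //; congr (_ * _); apply: (congr1 fine muJ). Qed.

Lemma mean_indic A : measurable A -> mean (\1_A) = mass A s0 s1.
Proof. by move=> mA; rewrite /mean /Rintegral integral_indic. Qed.

Lemma mean_le f g : bounded_mfun f -> bounded_mfun g ->
  (forall x, f x <= g x) -> mean f <= mean g.
Proof. by move=> hf hg fg; apply: le_Rintegral => //; exact: bounded_mfun_integrable. Qed.

Lemma chebyshev_mass f c : bounded_mfun f -> 0 < c ->
  mass [set x | c <= `|f x|] s0 s1 <= mean (fun x => f x * f x) / c ^+ 2.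
Proof.
move=> hf c0; set E := [set x | _].
have mE : measurable E.
  rewrite -[E]setTI -[E]/((fun s => c <= `|f s|) @^-1` [set true]).
  apply: (@measurable_fun_ler _ _ _ setT (cst c) (fun x => `|f x|)) => //.
  by apply: measurableT_comp => //; exact: hf.1.
rewrite ler_pdivlMr ?exprn_gt0 // mulrC -mean_indic // -meanZ; last first.
  exact: bounded_mfun_indic.
apply: mean_le.
- by apply: bounded_mfunM; [exact: bounded_mfun_cst | exact: bounded_mfun_indic].
- exact: bounded_mfunM.
move=> x; rewrite indicE; case: (boolP (x \in E)) => [|_]; last first.
  by rewrite mulr0 -expr2 sqr_ge0.
rewrite inE => Ex; rewrite mulr1 -expr2 -(real_normK (num_real (f x))).
by rewrite ler_pXn2r // nnegrE ltW.
Qed.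

Variables (g : nat -> rfun) (C r : R).
Hypothesis g_bounded : forall j, bounded_mfun (g j).
Hypothesis C_ge0 : 0 <= C.
Hypotheses (r_gt0 : 0 < r) (r_lt1 : r < 1).
Hypothesis decorrelated : forall j k,
  `|mean (fun x => g j x * g (j + k)%N x)| <= C * r ^+ k.

Notation S N := (fun x => \sum_(j < N) g j x).

Lemma mean_sumM N m : (N <= m)%N ->
  `|mean (fun x => S N x * g m x)| <= C * r ^+ (m - N).+1 / (1 - r).
Proof.
have r1 : 0 < 1 - r by rewrite subr_gt0.
elim: N => [|N IH] Nm.
  have -> : (fun x => S 0 x * g m x) = fun=> 0.
    by apply/funext => x; rewrite big_ord0 mul0r.
  rewrite mean_cst mul0r normr0 divr_ge0 ?mulr_ge0 ?exprn_ge0 // ltW //.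
have -> : (fun x => S N.+1 x * g m x) = (fun x => S N x * g m x + g N x * g m x).
  by apply/funext => x; rewrite big_ord_recr mulrDl.
rewrite meanD; [|by apply: bounded_mfunM => //; exact: bounded_mfun_sum|].
  2: exact: bounded_mfunM.
apply: le_trans (ler_normD _ _) _.
have hN := decorrelated N (m - N); rewrite subnKC ?(ltnW Nm) // in hN.
apply: le_trans (lerD (IH (ltnW Nm)) hN) _.
have -> : (m - N = (m - N.+1).+1)%N by rewrite subnSK.
rewrite !exprS le_eqVlt; apply/orP; left; apply/eqP.
by field; rewrite gt_eqF.
Qed.

(** The second moment grows only linearly because the correlations are summable. *)
Lemma second_moment N :
  mean (fun x => S N x * S N x) <= 3 * C / (1 - r) * N%:R.
Proof.
have r1 : 0 < 1 - r by rewrite subr_gt0.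
elim: N => [|N IH].
  have -> : (fun x => S 0 x * S 0 x) = fun=> 0.
    by apply/funext => x; rewrite big_ord0 mul0r.
  by rewrite mean_cst mul0r mulr0.
have -> : (fun x => S N.+1 x * S N.+1 x) =
    (fun x => (S N x * S N x + 2 * (S N x * g N x)) + g N x * g N x).
  by apply/funext => x; rewrite big_ord_recr /=; ring.
have bS := bounded_mfun_sum N g_bounded.
have bSg : bounded_mfun (fun x => S N x * g N x) by exact: bounded_mfunM.
have bSg2 : bounded_mfun (fun x => 2 * (S N x * g N x)).
  by apply: bounded_mfunM => //; exact: bounded_mfun_cst.
rewrite meanD; [|by apply: bounded_mfunD => //; exact: bounded_mfunM|].
  2: exact: bounded_mfunM.
rewrite meanD //; last exact: bounded_mfunM.
rewrite meanZ //.
have h1 : `|mean (fun x => S N x * g N x)| <= C / (1 - r).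
  apply: le_trans (mean_sumM (leqnn N)) _; rewrite subnn expr1.
  by rewrite ler_pM2r ?invr_gt0 // ler_piMr // ltW.
have h2 := decorrelated N 0; rewrite addn0 expr0 mulr1 in h2.
have h3 : C <= C / (1 - r).
  by rewrite ler_pdivlMr // ler_piMr //; move: r_gt0; lra.
have h4 : 2 * mean (fun x => S N x * g N x) <= 2 * (C / (1 - r)).
  by rewrite ler_pM2l // (le_trans (ler_norm _)).
have h5 := le_trans (ler_norm _) (le_trans h2 h3).
rewrite -[N.+1%:R]natr1 mulrDr mulr1; apply: le_trans (lerD (lerD IH h4) h5) _.
by rewrite -addrA lerD2l le_eqVlt; apply/orP; left; apply/eqP; ring.
Qed.

Lemma sum_inv_squares_le N : \sum_(n < N) (n.+1%:R ^+ 2)^-1 <= 2 - 2 / N.+1%:R :> R.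
Proof.
elim: N => [|N IH]; first by rewrite big_ord0 divr1 subrr.
rewrite big_ord_recr /=; apply: le_trans (lerD IH (lexx _)) _.
have a0 : 1 <= N.+1%:R :> R by rewrite ler1n.
set a : R := N.+1%:R in a0 *; have -> : N.+2%:R = a + 1 :> R by rewrite natr1.
rewrite -subr_ge0.
have -> : 2 - 2 / (a + 1) - (2 - 2 / a + (a ^+ 2)^-1) =
   (a - 1) / (a ^+ 2 * (a + 1)).
  by field; rewrite !gt_eqF //; lra.
by rewrite divr_ge0 ?mulr_ge0 ?exprn_ge0 //; lra.
Qed.

Hypothesis g_le1 : forall j x, `|g j x| <= 1.

(** By [second_moment] and Chebyshev's inequality, large partial sums at the times
[n.+1 ^ 2] have summable measures. The Borel-Cantelli lemma settles the squares
and [cesaro0_squares] the times in between. *)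
Lemma cesaro_ae : mu.-negligible (J `&` [set x | ~ cesaro0 (fun j => g j x)]).
Proof.
pose E q n : set (measurableTypeR R) :=
  J `&` [set x | (n.+1 ^ 2)%:R / q.+1%:R <= `|S (n.+1 ^ 2)%N x|].
have mE q n : measurable (E q n).
  apply: measurableI => //.
  rewrite -[X in measurable X]setTI.
  have [mS _] := bounded_mfun_sum (n.+1 ^ 2) g_bounded.
  apply: (@measurable_fun_ler _ _ _ setT (cst ((n.+1 ^ 2)%:R / q.+1%:R))
    (fun x => `|S (n.+1 ^ 2)%N x|) _ _ _ [set true]) => //.
  by apply: measurableT_comp.
pose K := 3 * C / (1 - r).
have K0 : 0 <= K.
  by rewrite /K divr_ge0 ?mulr_ge0 // ?subr_ge0 ltW.
have muE q n : (mu (E q n) <= (K * q.+1%:R ^+ 2 * (n.+1%:R ^+ 2)^-1)%:E)%E.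
  have bS := bounded_mfun_sum (n.+1 ^ 2) g_bounded.
  have c0 : 0 < (n.+1 ^ 2)%:R / q.+1%:R :> R by rewrite divr_gt0 ?ltr0n ?expn_gt0.
  have h1 := chebyshev_mass bS c0.
  have h2 := second_moment (n.+1 ^ 2).
  have finE : mu (E q n) \is a fin_num.
    rewrite ge0_fin_numE; last exact: measure_ge0.
    apply: (@le_lt_trans _ _ (mu J)); last exact: muJ_fin.
    by apply: le_measure; rewrite ?inE //; move=> x [].
  rewrite -[mu _]fineK // lee_fin /E setIC; apply: (le_trans h1).
  rewrite ler_pdivrMr ?exprn_gt0 //; apply: (le_trans h2).
  rewrite le_eqVlt; apply/orP; left; apply/eqP; rewrite -/K natrX.
  have a0 : n.+1%:R != 0 :> R by rewrite pnatr_eq0.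
  have b0 : q.+1%:R != 0 :> R by rewrite pnatr_eq0.
  move: a0 b0; move: n.+1%:R q.+1%:R => a b a0 b0.
  by field; rewrite a0 b0.
have null q : mu (lim_sup_set (E q)) = 0%E.
  apply: lim_sup_set_cvg0 => //.
  apply: (@le_lt_trans _ _ (K * q.+1%:R ^+ 2 * 2)%:E); last exact: ltry.
  apply: lime_le; first exact: is_cvg_ereal_nneg_natsum.
  apply: nearW => N; rewrite big_mkord.
  apply: (@le_trans _ _ (\sum_(n < N) (K * q.+1%:R ^+ 2 * (n.+1%:R ^+ 2)^-1)%:E)%E).
    by apply: lee_sum => n _; exact: muE.
  rewrite sumEFin lee_fin -mulr_sumr; apply: ler_wpM2l.
    by rewrite mulr_ge0 // exprn_ge0.
  apply: le_trans (sum_inv_squares_le N) _.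
  by rewrite gerBl divr_ge0.
have mL q : measurable (lim_sup_set (E q)).
  by apply: bigcapT_measurable => n; apply: bigcup_measurable => k _.
apply: (@negligibleS _ _ _ _ (\bigcup_q lim_sup_set (E q))); last first.
  by apply: negligible_bigcup => q; apply/negligibleP; [exact: mL | exact: null].
move=> x [Jx nc]; apply: contrapT => hx; apply: nc.
apply: cesaro0_squares => // q.
apply: contrapT => hq; apply: hx; exists q => // n0 _.
apply: contrapT => hn; apply: hq; exists n0 => n n0n.
rewrite ltNge; apply/negP => hge; apply: hn; exists n => //.
Qed.

End SecondMoment.

(** * Equidistribution along vertical lines *)

Definition discrepancy {R : realType} (a : R) (x : nat -> R) (n : nat) : R :=
  (fpart (log10 (x n)) < a)%R%:R - a.

Lemma subgradient_continuous {R : realType} (f d : R -> R) :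
  (forall s, 0 < d s) -> (forall s t, d s * (t - s) <= f t - f s) ->
  continuous f.
Proof.
move=> d0 sub s; apply/cvgrPdist_le => e e0.
have mono u v : u <= v -> d u <= d v by exact: (subgradient_mono sub).
have /cvgrPdist_le close : id @ s --> s by exact: cvg_id.
near=> t.
have ts : `|s - t| <= 1 /\ `|s - t| <= e / d (s + 1).
  split; near: t; apply: close => //.
  by rewrite divr_gt0.
have [ts1 ts2] := ts.
have t1 : t <= s + 1 by move: ts1; rewrite ler_norml; lra.
have h1 := sub s t; have h2 := sub t s.
have dt : d t <= d (s + 1) by apply: mono.
have ds : d s <= d (s + 1) by apply: mono; lra.
have ds1 := d0 (s + 1).
have main : d (s + 1) * `|s - t| <= e by rewrite mulrC -ler_pdivlMr.
apply: le_trans main.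
have [st|ts'] := leP s t.
  rewrite distrC ger0_norm ?subr_ge0 //; last first.
    by rewrite -subr_ge0; apply: le_trans h1; rewrite mulr_ge0 ?subr_ge0 // ltW.
  rewrite distrC ger0_norm ?subr_ge0 //.
  apply: (@le_trans _ _ (d t * (t - s))); first by move: h2; lra.
  by rewrite ler_wpM2r ?subr_ge0.
have {}ts := ltW ts'.
rewrite ger0_norm; last first.
  by apply: le_trans h2; rewrite mulr_ge0 ?subr_ge0 // ltW.
rewrite ger0_norm ?subr_ge0 //.
apply: (@le_trans _ _ (d s * (s - t))); first by move: h1; lra.
by rewrite ler_wpM2r ?subr_ge0.
Unshelve. all: by end_near. Qed.

Lemma negligible_subsingleton {R : realType} (A : set (measurableTypeR R)) :
  (forall s t : R, A s -> A t -> ~ (s < t)) -> (@lebesgue_measure R).-negligible A.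
Proof.
move=> h; have [[s As]|no] := pselect (exists s, A s); last first.
  apply: (@negligibleS _ _ _ _ set0); last exact: negligible_set0.
  by move=> s As; case: no; exists s.
apply: (@negligibleS _ _ _ _ [set s]).
  move=> t At /=; apply/eqP; rewrite eq_le !leNgt; apply/andP.
  by split; apply/negP; exact: h.
by apply/negligibleP; [exact: measurable_set1 | exact: lebesgue_measure_set1].
Qed.

Section FamilyAE.
Context {R : realType}.
Variables (a1 a2 b1 b2 : R).
Hypotheses (a1_gt0 : 0 < a1) (a2_gt0 : 0 < a2).
Hypotheses (b1_gt1 : 1 < b1) (b2_gt1 : 1 < b2).
Notation wt := (weight a1 b1).
Notation fslope X s := (slope b1 b2 (wt (X s))).
Notation mu := (@lebesgue_measure R).

Lemma ln10_gt0 : 0 < ln 10 :> R.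
Proof. by rewrite ln_gt0 // ltr1n. Qed.

Lemma family_chart X n : log_family a1 a2 b1 b2 X ->
  chart (fun s => log10 (X s n.+1)) (fun s => fslope X s n.+1 / ln 10).
Proof.
move=> famX.
have d0 s : 0 < fslope X s n.+1 / ln 10.
  by rewrite divr_gt0 ?ln10_gt0 // (family_slope_gt0 a1_gt0 a2_gt0 b1_gt1 b2_gt1 famX).
have sub s t : fslope X s n.+1 / ln 10 * (t - s) <=
    log10 (X t n.+1) - log10 (X s n.+1).
  rewrite /log10 -mulrBl mulrAC ler_pM2r ?invr_gt0 ?ln10_gt0 //.
  exact: (family_subgradient a1_gt0 a2_gt0 b1_gt1 b2_gt1).
by split=> //; apply: subgradient_continuous d0 sub.
Qed.

Lemma discrepancy_le1 a x n : 0 < a < 1 -> `|discrepancy a x n : R| <= 1.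
Proof.
move=> /andP[h0 h1]; rewrite /discrepancy ler_norml.
by case: (_ < _); apply/andP; split; rewrite ?mulr0n ?mulr1n; lra.
Qed.

(** Indices of equal parity are treated together, since [family_growth] compares
slopes two steps apart. For them [covar_bound] and [mass_window] give
correlations that decay like powers of the inverse of [rate]. *)
Lemma settled_interval_ae X s0 s1 a : log_family a1 a2 b1 b2 X -> s0 <= s1 ->
  0 < a < 1 -> escapes (X s0) \/ vanishes (X s1) ->
  mu.-negligible ([set` `[s0, s1[] `&`
    [set s | ~ cesaro0 (discrepancy a (X s))]).
Proof.
move=> famX s01 a01 esc; have /andP[a0 a1'] := a01.
have [kap kap0 hkap] := family_growth a1_gt0 a2_gt0 b1_gt1 b2_gt1.
have [n1 hn1] := hkap X s0 s1 famX s01 esc.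
pose r := (rate b1 b2)^-1.
have rate1 := rate_gt1 b1_gt1 b2_gt1.
have rate0 : 0 < rate b1 b2 := lt_trans ltr01 rate1.
have r0 : 0 < r by rewrite invr_gt0.
have r1 : r < 1 by rewrite invf_lt1.
pose f n s := log10 (X s n.+1).
pose d n s := fslope X s n.+1 / ln 10.
have ch n : chart (f n) (d n) := family_chart n famX.
pose del := Num.min 1 (fslope X s0 2) / ln 10.
have del0 : 0 < del.
  rewrite divr_gt0 ?ln10_gt0 // lt_min ltr01.
  exact: (family_slope_gt0 a1_gt0 a2_gt0 b1_gt1 b2_gt1 famX).
have d_del n : del <= d n s0.
  rewrite ler_pM2r ?invr_gt0 ?ln10_gt0 //.
  exact: (family_slope_lower a1_gt0 a2_gt0 b1_gt1 b2_gt1 famX).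
have dpos n : 0 < d n s0 by apply: lt_le_trans (d_del n).
pose C := (3 / del + (s1 - s0)) / kap.
have C0 : 0 <= C.
  have h3 : 0 < 3 / del by rewrite divr_gt0.
  by apply: divr_ge0; [apply: addr_ge0; [exact: ltW | rewrite subr_ge0] | exact: ltW].
pose bad i : set (measurableTypeR R) := [set` `[s0, s1[] `&` [set s | ~
  cesaro0 (fun j => discrepancy a (X s) (n1 + i + j.*2).+1)].
have main i : mu.-negligible (bad i).
  pose g j (s : measurableTypeR R) : R := discrepancy a (X s) (n1 + i + j.*2).+1.
  pose W j := window a (f (n1 + i + j.*2)%N).
  have mW j : measurable (W j) by apply: measurable_window; case: (ch (n1 + i + j.*2)%N).
  have gE j : g j = (fun s => \1_(W j) s + - a).
    apply/funext => s; rewrite /g /discrepancy indicE; congr (_%:R - _).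
    by congr nat_of_bool; apply/idP/idP; rewrite inE.
  have gb j : bounded_mfun (g j).
    rewrite gE; apply: bounded_mfunD; last exact: bounded_mfun_cst.
    exact: bounded_mfun_indic.
  apply: (@cesaro_ae _ s0 s1 s01 g C r gb C0 r0 r1) => //; last first.
    by move=> j s; exact: discrepancy_le1.
  move=> j k.
  have -> : (fun x => g j x * g (j + k)%N x) = (fun s =>
     (\1_(W (j + k)%N `&` W j) s + - a * \1_(W j) s) +
     (- a * \1_(W (j + k)%N) s + a ^+ 2)).
    by apply/funext => s; rewrite !gE indicI /=; ring.
  have bI A : measurable A -> bounded_mfun (\1_A : measurableTypeR R -> R).
    exact: bounded_mfun_indic.
  have bZ A : measurable A ->
      bounded_mfun (fun s => - a * (\1_A : measurableTypeR R -> R) s).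
    by move=> mA; apply: bounded_mfunM; [exact: bounded_mfun_cst | exact: bI].
  have mWW : measurable (W (j + k)%N `&` W j) by exact: measurableI.
  rewrite !meanD //; first last; try by [exact: bI | exact: bZ | exact: bounded_mfun_cst
    | apply: bounded_mfunD; [exact: bI | exact: bZ]
    | apply: bounded_mfunD; [exact: bZ | exact: bounded_mfun_cst]].
  rewrite !meanZ //; try by [exact: bI | exact: bounded_mfun_cst].
  rewrite mean_cst // !mean_indic //.
  have c0 : 0 < kap * rate b1 b2 ^+ k by rewrite mulr_gt0 ?exprn_gt0.
  have growth s : s0 <= s <= s1 -> kap * rate b1 b2 ^+ k *
      d (n1 + i + j.*2)%N s <= d (n1 + i + (j + k).*2)%N s.
    move=> hs; rewrite /d mulrA ler_pM2r ?invr_gt0 ?ln10_gt0 //.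
    rewrite doubleD addnA -addSn; apply: hn1 => //.
    by rewrite -!addnS -addnA leq_addr.
  have cov := covar_bound (ch (n1 + i + (j + k).*2)%N) (ch (n1 + i + j.*2)%N)
    a01 c0 s01 growth.
  have win := mass_window (ch (n1 + i + (j + k).*2)%N) a01 s01.
  have -> : mass (W (j + k)%N `&` W j) s0 s1 + - a * mass (W j) s0 s1 +
      (- a * mass (W (j + k)%N) s0 s1 + a * (a * (s1 - s0))) =
      covar a (f (n1 + i + (j + k).*2)%N) (f (n1 + i + j.*2)%N) s0 s1 -
      a * (mass (W (j + k)%N) s0 s1 - a * (s1 - s0)).
    by rewrite /covar /W; ring.
  apply: le_trans (ler_normB _ _) _; rewrite normrM (gtr0_norm a0).
  have e0 : (d (n1 + i + j.*2)%N s0)^-1 <= del^-1.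
    by rewrite lef_pV2 ?posrE.
  have d_inv : (d (n1 + i + (j + k).*2)%N s0)^-1 <= del^-1 / (kap * rate b1 b2 ^+ k).
    rewrite -invfM lef_pV2 ?posrE; [|exact: dpos|exact: mulr_gt0].
    rewrite mulrC; apply: le_trans (growth s0 _); last by rewrite lexx.
    by rewrite ler_pM2l.
  have win2 : a * `|mass (W (j + k)%N) s0 s1 - a * (s1 - s0)| <=
      del^-1 / (kap * rate b1 b2 ^+ k).
    apply: le_trans d_inv; apply: le_trans win.
    by rewrite ler_piMl // ltW.
  apply: le_trans (lerD cov win2) _.
  have -> : C * r ^+ k = (3 * del^-1 + (s1 - s0)) / (kap * rate b1 b2 ^+ k).
    by rewrite /C /r exprVn; field; rewrite ?expf_neq0 ?gt_eqF.
  by rewrite -mulrDl ler_pM2r ?invr_gt0 //; lra.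
apply: (@negligibleS _ _ _ _ (bad 0%N `|` bad 1%N)); last first.
  by apply: negligibleU; exact: main.
move=> s [Js nc]; apply: contrapT => /not_orP[h0 h1]; apply: nc.
apply: (@cesaro0_shift _ _ n1.+1); first by move=> j; exact: discrepancy_le1.
apply: cesaro0_parity.
  have /not_andP[//|/contrapT] := h0; rewrite addn0.
  by congr cesaro0.
have /not_andP[//|/contrapT] := h1.
congr cesaro0; apply/funext => j; congr discrepancy.
by rewrite addn1 addSn !addnS addSn.
Qed.

End FamilyAE.

Section FamilyLine.
Context {R : realType}.
Variables (a1 a2 b1 b2 : R).
Hypotheses (a1_gt0 : 0 < a1) (a2_gt0 : 0 < a2).
Hypotheses (b1_gt1 : 1 < b1) (b2_gt1 : 1 < b2).
Notation mu := (@lebesgue_measure R).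

Lemma rat_between (s t : R) : s < t -> exists2 q : rat, s < ratr q & ratr q < t.
Proof. by move=> /rat_in_itvoo[q]; rewrite in_itv /= => /andP[h1 h2]; exists q. Qed.

(** Such intervals abound: of two disjoint intervals next to each other, one has an
escaping left end or a vanishing right end. *)
Lemma settled_interval X (s : R) e : log_family a1 a2 b1 b2 X -> 0 < e ->
  exists r r' : R, [/\ s - e < r, r < r', r' < s + e &
    escapes (X r) \/ vanishes (X r')].
Proof.
move=> famX e0.
have e2 : 0 < e / 4 by rewrite divr_gt0.
have lt12 : s - e / 4 < s + e / 4 by lra.
have [esc|van] := family_dichotomy a1_gt0 a2_gt0 b1_gt1 b2_gt1 famX lt12.
  by exists (s + e / 4), (s + e / 2); split; [lra|lra|lra|left].
by exists (s - e / 2), (s - e / 4); split; [lra|lra|lra|right].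
Qed.

(** The rational intervals to which [settled_interval_ae] applies cover the line up
to at most one point, by [family_dichotomy]. *)
Lemma family_ae X : log_family a1 a2 b1 b2 X ->
  mu.-negligible [set s | exists2 q : rat, 0 < (ratr q : R) < 1 &
    ~ cesaro0 (discrepancy (ratr q) (X s))].
Proof.
move=> famX.
pose good (c : rat * rat * rat) : Prop := [/\ 0 < (ratr c.1.1 : R) < 1,
  (ratr c.1.2 : R) <= ratr c.2 &
  escapes (X (ratr c.1.2)) \/ vanishes (X (ratr c.2))].
pose cell (c : rat * rat * rat) : set (measurableTypeR R) :=
  [set s | good c /\ (ratr c.1.2 <= s < ratr c.2 /\
    ~ cesaro0 (discrepancy (ratr c.1.1) (X s)))].
have cellN c : mu.-negligible (cell c).
  have [[h1 h2 h3]|ng] := pselect (good c); last first.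
    apply: (@negligibleS _ _ _ _ set0); last exact: negligible_set0.
    by move=> s [].
  apply: negligibleS (settled_interval_ae a1_gt0 a2_gt0 b1_gt1 b2_gt1 famX h2 h1 h3).
  by move=> s [_ [sJ nc]]; split => //=; rewrite in_itv.
(* Two points of [rest] would enclose two rationals violating the dichotomy. *)
pose rest : set (measurableTypeR R) := [set s | forall r r' : rat,
  escapes (X (ratr r)) \/ vanishes (X (ratr r')) -> ~ (ratr r <= s < ratr r')].
have restN : mu.-negligible rest.
  apply: negligible_subsingleton => s t hs ht st.
  have [r sr rt] := rat_between st; have [r' rr' r't] := rat_between rt.
  have [r0 _ r0s] : exists2 q : rat, s - 1 < ratr q & ratr q < s.
    by apply: rat_between; lra.
  have [r1 tr1 _] : exists2 q : rat, t < ratr q & ratr q < t + 1.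
    by apply: rat_between; lra.
  have [esc|van] := family_dichotomy a1_gt0 a2_gt0 b1_gt1 b2_gt1 famX rr'.
    by apply: (ht r' r1); [left | rewrite (ltW r't) tr1].
  by apply: (hs r0 r); [right | rewrite (ltW r0s) sr].
pose F n := if unpickle n is Some c then cell c else set0.
apply: (@negligibleS _ _ _ _ ((\bigcup_n F n) `|` rest)); last first.
  apply: negligibleU => //; apply: negligible_bigcup => n; rewrite /F.
  by case: unpickle => [c|]; [exact: cellN | exact: negligible_set0].
move=> s [q q01 nc].
have [hr|nr] := pselect (rest s); [by right | left].
apply: contrapT => nF; apply: nr => r r' esc /andP[rs sr'].
have FE c : F (pickle c) = cell c by rewrite /F pickleK.
apply: nF; exists (pickle (q, r, r')); first exact: Logic.I.
rewrite FE; split; last by split=> //=; rewrite rs sr'.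
by split=> //=; rewrite ltW // (le_lt_trans rs).
Qed.

End FamilyLine.

(** * Null sets under the exponential function *)

Section ExpNull.
Context {R : realType}.
Notation mu := (@lebesgue_measure R).

(** The measure with density [expR]: it is Lebesgue measure on the positive
half-line, transported by [ln]. *)
Definition exp_weighted (A : set (measurableTypeR R)) : \bar R :=
  (\int[mu]_(s in A) (expR s)%:E)%E.

Lemma exp_weighted_itv (a b : R) : a < b ->
  exp_weighted [set` `]a, b]] = (expR b - expR a)%:E.
Proof.
move=> ab; rewrite /exp_weighted integral_itv_obnd_cbnd; last first.
  by apply/measurable_EFinP; apply: measurable_funTS; exact: measurable_expR.
rewrite (@continuous_FTC2 _ _ (@expR R)) //.
- by apply: continuous_subspaceT; exact: continuous_expR.
- split.
  + by move=> z _; exact: ex_derive.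
  + by apply/cvg_at_right_filter; exact: continuous_expR.
  + by apply/cvg_at_left_filter; exact: continuous_expR.
- by move=> z _; rewrite derive1E; have /funeqP -> := @derive_expR R.
Qed.

Let exp_weighted0 : exp_weighted set0 = 0%E.
Proof. by rewrite /exp_weighted integral_set0. Qed.

Let exp_weighted_ge0 A : (0 <= exp_weighted A)%E.
Proof. by apply: integral_ge0 => s _; rewrite lee_fin expR_ge0. Qed.

Let exp_weighted_sigma_additive : semi_sigma_additive exp_weighted.
Proof.
apply: semi_sigma_additive_nng_induced.
  by apply/measurable_EFinP; exact: measurable_expR.
by move=> s; rewrite lee_fin expR_ge0.
Qed.

HB.instance Definition _ := isMeasure.Build _ _ _ exp_weighted
  exp_weighted0 exp_weighted_ge0 exp_weighted_sigma_additive.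

Let mpos : measurable ([set` `]0, +oo[] : set (measurableTypeR R)).
Proof. exact: measurable_itv. Qed.


Lemma ln_pushforward (A : set (measurableTypeR R)) : measurable A ->
  mu ((@ln R @^-1` A) `&` [set` `]0, +oo[]) = exp_weighted A.
Proof.
have mln : measurable_fun setT (@ln R : measurableTypeR R -> measurableTypeR R).
  exact: measurable_ln.
pose m1 : {measure set (measurableTypeR R) -> \bar R} :=
  measure_function_pushforward__canonical__measure_function_Measure
    (mrestr mu mpos) mln.
have m1E B : m1 B = mu ((@ln R @^-1` B) `&` [set` `]0, +oo[]) by [].
have m1itv (a b : R) : a < b -> m1 [set` `]a, b]] = (expR b - expR a)%:E.
  move=> ab; rewrite m1E (_ : _ `&` _ = [set` `]expR a, expR b]]).
    by rewrite lebesgue_measure_itv /= lte_fin ltr_expR ab EFinB.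
  apply/seteqP; split=> x /=; rewrite !in_itv /= ?andbT.
    move=> [/andP[h1 h2] x0].
    by rewrite -[x]lnK ?posrE // ltr_expR ler_expR h1.
  move=> /andP[h1 h2]; have x0 : 0 < x by apply: lt_trans h1; exact: expR_gt0.
  by split=> //; rewrite -ltr_expR -ler_expR lnK ?posrE // h1.
move=> mA; rewrite -m1E.
apply: (@measure_unique _ R (measurableTypeR R) (@ocitv R)
  (fun k : nat => [set` `](- k%:R), k%:R]]) _ _ _ _ m1 exp_weighted) => //.
- exact: ocitvI.
- by move=> k; exact: is_ocitv.
- apply/seteqP; split=> // x _; have [k hk] := exists_nat_ge (`|x| + 1).
  exists k => //=; rewrite in_itv /=; move: hk.
  have := ler_norm x; have := lerNnormlW (lexx `|x|).
  by move=> h1 h2 h3; apply/andP; split; lra.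
- move=> X /ocitvP[->|[[a b] /= ab ->]]; first by rewrite !measure0.
  by rewrite m1itv // exp_weighted_itv.
move=> k; have [k0|k0] := ltP (- k%:R : R) k%:R.
  by rewrite m1itv // ltry.
by rewrite set_itv_ge ?measure0 // -leNgt.
Qed.

(** Null sets of the logarithmic coordinate are null sets of initial values. *)
Lemma null_exp (A : set (measurableTypeR R)) : measurable A ->
  (forall x, A x -> 0 < x) -> mu.-negligible (@expR R @^-1` A) -> mu A = 0%E.
Proof.
move=> mA A0 negl.
have mE : measurable (@expR R @^-1` A : set (measurableTypeR R)).
  by rewrite -[X in measurable X]setTI; exact: measurable_expR.
have -> : A = (@ln R @^-1` (@expR R @^-1` A)) `&` [set` `]0, +oo[].
  apply/seteqP; split=> x /=; rewrite in_itv /= andbT.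
    by move=> Ax; rewrite lnK ?posrE ?A0.
  by move=> [+ x0]; rewrite lnK ?posrE.
rewrite ln_pushforward //; apply: null_set_integral => //.
  by apply/measurable_EFinP; apply: measurable_funTS; exact: measurable_expR.
exact/negligibleP.
Qed.

End ExpNull.

(** * Benford sequences and fractional parts *)

Section Significand.
Context {R : realType}.
Implicit Types (x t : R).

Lemma ln_exp10 (k : int) : ln (10 ^ k : R) = k%:~R * ln 10.
Proof. by rewrite -powR_intmul // ln_powR. Qed.

Lemma exp10_gt0 (k : int) : 0 < (10 ^ k : R).
Proof. by rewrite -powR_intmul // powR_gt0. Qed.

Lemma log10_significand x : 0 < x ->
  0 < significand x /\ log10 (significand x) = fpart (log10 x).
Proof.
move=> x0; have l10 : 0 < ln 10 :> R := ln10_gt0.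
rewrite /significand; case: xgetP => [t _ [/andP[t1 t10] [k xk]]|none].
  rewrite gtr0_norm // in xk.
  have t0 : 0 < t := lt_le_trans ltr01 t1.
  split=> //; rewrite (@fpartE _ k).
    rewrite xk /log10 lnM ?posrE ?exp10_gt0 // ln_exp10.
    by field; rewrite gt_eqF.
  have -> : log10 x = k%:~R + log10 t.
    rewrite xk /log10 lnM ?posrE ?exp10_gt0 // ln_exp10.
    by field; rewrite gt_eqF.
  rewrite lerDl ltrD2l /log10; apply/andP; split.
    by apply: divr_ge0; [exact: ln_ge0 | exact: ltW].
  by rewrite ltr_pdivrMr // mul1r ltr_ln ?posrE.
pose k := Num.floor (log10 x).
have /andP[k1 k2] := floor_itv (log10 x).
have lnx : ln x = log10 x * ln 10 by rewrite /log10 mulfVK // gt_eqF.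
case: (none (x / 10 ^ k)); split; last first.
  by exists k; rewrite gtr0_norm // mulrCA divff ?mulr1 // gt_eqF // exp10_gt0.
have d0 : 0 < x / 10 ^ k by rewrite divr_gt0 // exp10_gt0.
have lnd : ln (x / 10 ^ k) = (log10 x - k%:~R) * ln 10.
  by rewrite ln_div ?posrE ?exp10_gt0 // ln_exp10 lnx mulrBl.
rewrite -ler_ln ?posrE // -ltr_ln ?posrE // ln1 lnd.
rewrite mulr_ge0 ?subr_ge0 ?(ltW l10) //=.
by rewrite -[ltRHS]mul1r ltr_pM2r // ltrBlDl -intrD1.
Qed.

Lemma significand_le x t : 0 < x -> 1 <= t ->
  (significand x <= t) = (fpart (log10 x) <= log10 t).
Proof.
move=> x0 t1; have [s0 <-] := log10_significand x0.
rewrite /log10 ler_pM2r ?invr_gt0 ?ln10_gt0 //.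
by rewrite ler_ln ?posrE // (lt_le_trans ltr01).
Qed.

End Significand.

Section BenfordCriterion.
Context {R : realType}.
Implicit Types (x : nat -> R).

Definition ncount (P : nat -> bool) (N : nat) : R := \sum_(j < N) (P j)%:R.

Lemma ncount_le (P Q : nat -> bool) N : (forall j, P j -> Q j) ->
  ncount P N <= ncount Q N.
Proof.
move=> h; apply: ler_sum => j _; rewrite ler_nat.
by have := h j; case: (P j) => // ->.
Qed.

Lemma ncount_discrepancy a x N :
  ncount (fun j => fpart (log10 (x j)) < a) N =
  \sum_(j < N) discrepancy a x j + a * N%:R.
Proof.
rewrite /discrepancy sumrB sumr_const card_ord -(mulr_natr a).
by rewrite subrK.
Qed.

Lemma card_ncount (P : nat -> bool) N :
  #|[pred i : 'I_N | P i]|%:R = ncount P N.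
Proof.
by rewrite /ncount -natr_sum -sum1_card big_mkcond.
Qed.

(** Both distribution functions are monotone and the limit is continuous, so
rational levels suffice. *)
Lemma benford_of_cesaro x : (forall n, 0 < x n) ->
  (forall q : rat, 0 < (ratr q : R) < 1 -> cesaro0 (discrepancy (ratr q) x)) ->
  benford x.
Proof.
move=> x0 ces t /andP[t1 t10].
pose tau := log10 t.
have l10 : 0 < ln 10 :> R := ln10_gt0.
have tau0 : 0 <= tau by apply: divr_ge0; [exact: ln_ge0 | exact: ltW].
have tau1 : tau < 1.
  by rewrite /tau /log10 ltr_pdivrMr // mul1r ltr_ln ?posrE // (lt_le_trans ltr01).
pose P j := fpart (log10 (x j)) <= tau.
have main e : 0 < e -> exists N0, forall N, (N0 <= N)%N ->
    `|ncount P N - tau * N%:R| <= e * N%:R.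
  move=> e0.
  have [q q1 q2] : exists2 q : rat, tau < ratr q & ratr q < Num.min 1 (tau + e / 2).
    by apply: rat_between; rewrite lt_min tau1 /=; lra.
  move: q2; rewrite lt_min => /andP[q2 q3].
  have e2 : 0 < e / 2 by rewrite divr_gt0.
  have q01 : 0 < (ratr q : R) < 1 by rewrite q2 (le_lt_trans tau0).
  have [N1 hN1] := ces q q01 _ e2.
  have upper N : (N1 <= N)%N -> ncount P N - tau * N%:R <= e * N%:R.
    move=> hN; have := hN1 N hN => /(le_trans (ler_norm _)) h.
    have hc := @ncount_le P (fun j => fpart (log10 (x j)) < ratr q) N
      (fun j hj => le_lt_trans hj q1).
    move: hc; rewrite ncount_discrepancy => hc.
    have hq : ratr q * N%:R <= (tau + e / 2) * N%:R :> R.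
      by rewrite ler_wpM2r // ltW.
    by move: hq; rewrite mulrDl; lra.
  have [tau_gt0|tau_le0] := ltP 0 tau; last first.
    exists N1 => N hN; rewrite ler_norml upper // andbT.
    have -> : tau = 0 by apply/eqP; rewrite eq_le tau_le0.
    rewrite mul0r subr0; apply: (@le_trans _ _ 0).
      by rewrite oppr_le0 mulr_ge0 // ltW.
    by apply: sumr_ge0.
  have [q' q'1 q'2] : exists2 q : rat, Num.max 0 (tau - e / 2) < ratr q & ratr q < tau.
    by apply: rat_between; rewrite gt_max tau_gt0 /=; lra.
  move: q'1; rewrite gt_max => /andP[q'0 q'1].
  have q'01 : 0 < (ratr q' : R) < 1 by rewrite q'0 (lt_trans q'2).
  have [N2 hN2] := ces q' q'01 _ e2.
  exists (maxn N1 N2) => N; rewrite geq_max => /andP[hNN1 hNN2].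
  rewrite ler_norml upper // andbT.
  have := hN2 N hNN2; rewrite ler_norml => /andP[h _].
  have hc := @ncount_le (fun j => fpart (log10 (x j)) < ratr q') P N
    (fun j hj => ltW (lt_trans hj q'2)).
  move: hc; rewrite ncount_discrepancy => hc.
  have hq : (tau - e / 2) * N%:R <= ratr q' * N%:R :> R.
    by rewrite ler_wpM2r // ltW.
  by move: hq; rewrite mulrBl; lra.
apply/cvgrPdist_le => e e0; have [N0 hN0] := main e e0.
exists N0.+1 => // N /= hN.
have N_gt0 : 0 < N%:R :> R by rewrite ltr0n (leq_ltn_trans _ hN).
have -> : #|[pred i : 'I_N | significand (x i) <= t]|%:R = ncount P N.
  rewrite -card_ncount; congr _%:R; apply: eq_card => i.
  by rewrite !inE significand_le.
rewrite -/tau distrC.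
have -> : ncount P N / N%:R - tau = (ncount P N - tau * N%:R) / N%:R.
  by field; rewrite gt_eqF.
rewrite normrM normfV (gtr0_norm N_gt0) ler_pdivrMr //.
by apply: hN0; exact: ltnW.
Qed.

Lemma benford_ncount x t : benford x -> (forall n, 0 < x n) -> 1 <= t < 10 ->
  forall e, 0 < e -> exists N0, forall N, (N0 <= N)%N ->
  ncount (fun j => fpart (log10 (x j)) <= log10 t) N <= (log10 t + e) * N%:R.
Proof.
move=> bx x0 t1 e e0; have /cvgrPdist_le/(_ e e0) [N0 _ hN0] := bx t t1.
exists N0.+1 => N hN; have := hN0 N (ltnW hN) => /=.
have N_gt0 : 0 < N%:R :> R by rewrite ltr0n (leq_ltn_trans _ hN).
have -> : #|[pred i : 'I_N | significand (x i) <= t]|%:R =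
    ncount (fun j => fpart (log10 (x j)) <= log10 t) N.
  rewrite -card_ncount; congr _%:R; apply: eq_card => i.
  by rewrite !inE significand_le //; case/andP: t1.
by rewrite distrC ler_norml lerBlDl ler_pdivrMr // => /andP[].
Qed.

End BenfordCriterion.

(** * Full measure *)

Section Plane.
Context {R : realType}.
Variables (a1 a2 b1 b2 : R).
Hypotheses (a1_gt0 : 0 < a1) (a2_gt0 : 0 < a2).
Hypotheses (b1_gt1 : 1 < b1) (b2_gt1 : 1 < b2).
Notation mu := (@lebesgue_measure R).
Notation rseq := (rec_seq a1 a2 b1 b2).

Lemma rec_solution x : pos_quadrant x -> solution a1 a2 b1 b2 (rseq x).
Proof. by case=> h1 h2; split. Qed.

Lemma vertical_family (x1 : R) : 0 < x1 ->
  log_family a1 a2 b1 b2 (fun s => rseq (x1, expR s)).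
Proof.
move=> x10; split=> //.
  by move=> s; apply: rec_solution; split => //=; exact: expR_gt0.
by move=> s t; rewrite /= !expRK.
Qed.

Let T2 := (measurableTypeR R * measurableTypeR R)%type.

Lemma measurable_rec n : measurable_fun setT (fun x : T2 => rseq x n).
Proof.
suff [] : measurable_fun setT (fun x : T2 => rseq x n) /\
          measurable_fun setT (fun x : T2 => rseq x n.+1) by [].
elim: n => [|n [IH0 IH1]].
  by split; [exact: measurable_fst | exact: measurable_snd].
split=> //; apply: measurable_funD; apply: measurable_funM => //.
  exact: (measurableT_comp (@measurable_powR R b1)).
exact: (measurableT_comp (@measurable_powR R b2)).
Qed.

Lemma measurable_discrepancy a n :
  measurable_fun setT (fun x : T2 => discrepancy a (rseq x) n).
Proof.
apply: measurable_funB => //.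
have ml : measurable_fun setT (fun x : T2 => fpart (log10 (rseq x n))).
  apply: (measurableT_comp measurable_fpart); apply: measurable_funM => //.
  exact: (measurableT_comp (@measurable_ln R)) (measurable_rec n).
pose b (x : T2) := fpart (log10 (rseq x n)) < a.
have mb : measurable_fun setT b by apply: measurable_fun_ltr.
rewrite (_ : (fun x => _) = \1_[set x | b x]).
  by apply: measurable_indic; rewrite -[X in measurable X]setTI; exact: (mb _ [set true]).
apply/funext => x; rewrite indicE; congr (nat_of_bool _)%:R.
by apply/idP/idP; rewrite inE.
Qed.

Lemma cesaro0P (u : nat -> R) : cesaro0 u <-> forall p : nat, exists N0,
  forall N, (N0 <= N)%N -> `|\sum_(j < N) u j| <= p.+1%:R^-1 * N%:R.
Proof.
split=> [h p|h e e0]; first by apply: h; rewrite invr_gt0.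
have [p hp] := exists_nat_ge e^-1; have [N0 hN0] := h p.
exists N0 => N hN; apply: le_trans (hN0 N hN) _; rewrite ler_wpM2r //.
rewrite -[leRHS]invrK lef_pV2 ?posrE ?invr_gt0 //.
by apply: (le_trans hp); rewrite ler_nat.
Qed.

Lemma measurable_cesaro0 a :
  measurable [set x : T2 | cesaro0 (discrepancy a (rseq x))].
Proof.
rewrite (_ : [set x | _] = \bigcap_p \bigcup_N0 \bigcap_(N in [set N | (N0 <= N)%N])
  [set x : T2 | `|\sum_(j < N) discrepancy a (rseq x) j| <= p.+1%:R^-1 * N%:R]).
  apply: bigcapT_measurable => p; apply: bigcupT_measurable => N0.
  apply: bigcap_measurable => [|N _]; first by exists N0 => /=.
  have mS : measurable_fun setT
      (fun x : T2 => \sum_(j < N) discrepancy a (rseq x) j).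
    elim: N => [|N IH]; first by under eq_fun do rewrite big_ord0; exact: measurable_cst.
    under eq_fun do rewrite big_ord_recr /=.
    by apply: measurable_funD => //; exact: measurable_discrepancy.
  rewrite -[X in measurable X]setTI.
  apply: (@measurable_fun_ler _ _ _ setT
    (fun x : T2 => `|\sum_(j < N) discrepancy a (rseq x) j|)
    (cst (p.+1%:R^-1 * N%:R)) _ _ _ [set true]) => //.
  exact: (measurableT_comp (@normr_measurable R setT)).
apply/seteqP; split=> x /=.
  move=> /cesaro0P h p _; have [N0 hN0] := h p.
  by exists N0 => // N hN; exact: hN0.
move=> h; apply/cesaro0P => p; have [N0 _ hN0] := h p Logic.I.
by exists N0 => N hN; exact: hN0.
Qed.

(** A measurable superset of the non-Benford initial values: only countably many
levels are tested. *)
Definition bad_plane : set T2 := [set x | 0 < x.1 /\ 0 < x.2] `&`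
  \bigcup_(q in [set q : rat | 0 < (ratr q : R) < 1])
    ~` [set x : T2 | cesaro0 (discrepancy (ratr q) (rseq x))].

Lemma measurable_bad_plane : measurable bad_plane.
Proof.
apply: measurableI.
  rewrite (_ : [set _ | _] = ([set` `]0, +oo[] : set (measurableTypeR R)) `*`
     ([set` `]0, +oo[] : set (measurableTypeR R))).
    by apply: measurableX; exact: measurable_itv.
  by apply/seteqP; split=> x /=; rewrite !in_itv /= !andbT.
rewrite bigcup_mkcond; apply: bigcupT_measurable_rat => q.
by case: ifP => // _; apply: measurableC; exact: measurable_cesaro0.
Qed.

(** Tonelli: every vertical section is null by [family_ae] and [null_exp]. *)
Lemma bad_plane_null : (mu \x mu)%E bad_plane = 0%E.
Proof.
rewrite /product_measure1 /=; apply: integral0_eq => x1 _ /=.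
have mx : measurable (xsection bad_plane x1).
  exact: measurable_xsection measurable_bad_plane.
apply: null_exp => //.
  by move=> x2; rewrite xsectionE => -[[]].
have [x10|x10] := ltP 0 x1; last first.
  apply: (@negligibleS _ _ _ _ set0); last exact: negligible_set0.
  by move=> s /=; rewrite xsectionE => -[[/=]]; rewrite ltNge x10.
apply: negligibleS (family_ae a1_gt0 a2_gt0 b1_gt1 b2_gt1 (vertical_family x10)).
by move=> s /=; rewrite xsectionE => -[_ [q hq nc]]; exists q.
Qed.

Lemma benford_full_measure : full_measure_in pos_quadrant
  [set x : R * R | pos_quadrant x /\ benford (rseq x)].
Proof.
exists bad_plane; split; [exact: measurable_bad_plane|exact: bad_plane_null|].
move=> x [px nb]; split => //; apply: contrapT => nbad; apply: nb; split=> //.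
apply: benford_of_cesaro.
  by move=> n; apply: (solution_gt0 a1_gt0 a2_gt0) (rec_solution px).
move=> q hq; apply: contrapT => nc; apply: nbad; exists q => //.
Qed.

End Plane.

(** * Nested intervals *)

Section ChartCompare.
Context {R : realType}.
Implicit Types (f g d e : R -> R).

(** On a subdivision into equal parts the increments are compared through the
slopes at the nodes, up to the mesh times the variation of [e]; the mesh is
arbitrarily small. *)
Lemma chart_compare f d g e (c u v : R) : chart f d -> chart g e -> 0 <= c ->
  u <= v -> (forall s, u <= s <= v -> c * e s <= d s) ->
  c * (g v - g u) <= f v - f u.
Proof.
move=> cf cg c0 uv ced.
have [_ df0 subf] := cf; have [_ _ subg] := cg.
pose A := c * (e v - e u) * (v - u).
have bound (n : nat) : (0 < n)%N -> c * (g v - g u) <= f v - f u + A / n%:R.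
  move=> n0; have n_gt0 : 0 < n%:R :> R by rewrite ltr0n.
  pose h := (v - u) / n%:R; have h0 : 0 <= h by rewrite divr_ge0 ?subr_ge0.
  pose pt i : R := u + i%:R * h.
  have ptS i : pt i.+1 - pt i = h by rewrite /pt -natr1; ring.
  have ptn : pt n = v by rewrite /pt /h; field; rewrite gt_eqF.
  have pt0 : pt 0%N = u by rewrite /pt mul0r addr0.
  have pt_in i : (i <= n)%N -> u <= pt i <= v.
    move=> ni; rewrite -ptn /pt lerDl mulr_ge0 //= lerD2l.
    by rewrite ler_wpM2r // ler_nat.
  have part i : (i <= n)%N -> c * (g (pt i) - g u) <=
      f (pt i) - f u + c * (e (pt i) - e u) * h.
    elim: i => [|i IH] hi; first by rewrite pt0 !subrr mulr0 mul0r addr0.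
    have {}IH := IH (ltnW hi).
    have hg := subg (pt i.+1) (pt i).
    have hf := subf (pt i) (pt i.+1); rewrite ptS in hf.
    have hg' : g (pt i.+1) - g (pt i) <= e (pt i.+1) * h.
      by move: hg; rewrite -opprB ptS mulrN; lra.
    have hc := ler_wpM2l c0 hg'.
    have hd : c * e (pt i) * h <= d (pt i) * h.
      by rewrite ler_wpM2r // ced // pt_in // ltnW.
    by move: IH hc hd hf; rewrite !mulrBr !mulrBl; lra.
  have := part n (leqnn n); rewrite ptn.
  by rewrite (_ : c * (e v - e u) * h = A / n%:R) // /A /h mulrA.
have A0 : 0 <= A.
  by rewrite !mulr_ge0 ?subr_ge0 // (chart_slope_le cg).
rewrite leNgt; apply/negP; rewrite -subr_gt0.
set z : R := c * _ - _ => z0.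
have [n hn] := exists_nat_ge (A / z).
have h := bound n.+1 isT.
have : A / n.+1%:R < z.
  rewrite ltr_pdivrMr // -ltr_pdivrMl // mulrC.
  by apply: (le_lt_trans hn); rewrite ltr_nat.
by move: h; rewrite /z; move: (A / _) => q; lra.
Qed.

End ChartCompare.

Section Nested.
Context {R : realType}.
Variables (a1 a2 b1 b2 : R).
Hypotheses (a1_gt0 : 0 < a1) (a2_gt0 : 0 < a2).
Hypotheses (b1_gt1 : 1 < b1) (b2_gt1 : 1 < b2).
Notation wt := (weight a1 b1).
Notation fslope X s := (slope b1 b2 (wt (X s))).

Lemma chart_window f d (u v eps : R) : chart f d -> 0 < eps <= 1 -> u <= v ->
  2 <= f v - f u -> exists (k : int) u' v', [/\ u <= u', u' < v', v' <= v,
    f u' = k%:~R & f v' = k%:~R + eps].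
Proof.
move=> cf /andP[eps0 eps1] uv fuv.
pose k := Num.floor (f u) + 1.
have /andP[k1 k2] := floor_itv (f u).
have kE : k%:~R = (Num.floor (f u))%:~R + 1 :> R by rewrite /k intrD.
have ku : f u < k%:~R by [].
have [|u' /andP[uu' u'v] fu'] := chart_ivt (v := k%:~R) cf uv.
  by rewrite (ltW ku) kE; move: fuv; lra.
have [|v' /andP[u'v' v'v] fv'] := chart_ivt (v := k%:~R + eps) cf u'v.
  by rewrite fu' lerDl ltW //= kE; move: fuv; lra.
exists k, u', v'; split=> //.
by apply: (chart_lt_inv cf); rewrite fu' fv' ltrDl.
Qed.

Definition hit (eps : R) (x : nat -> R) (n : nat) : bool :=
  0 < fpart (log10 (x n)) < eps.

Lemma ncount_mono (P : nat -> bool) m n : (m <= n)%N ->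
  ncount P m <= ncount P n :> R.
Proof.
move=> mn; rewrite -(subnKC mn); elim: (n - m)%N => [|k IH]; first by rewrite addn0.
by rewrite addnS {2}/ncount big_ord_recr /= ler_wpDr.
Qed.

Lemma ncount_spaced (P : nat -> bool) M L r : (0 < L)%N ->
  (forall i, (i <= r)%N -> P (M + i * L)%N) ->
  r.+1%:R <= ncount P (M + r * L).+1 :> R.
Proof.
move=> L0; elim: r => [|r IH] hP; rewrite /ncount big_ord_recr /= hP //.
  by rewrite lerDr; apply: sumr_ge0.
rewrite -[r.+2%:R]natr1 lerD2r; apply: le_trans (IH _) _.
  by move=> i hi; apply: hP; exact: leqW.
by apply: ncount_mono; rewrite ltn_add2l ltn_mul2r L0 ltnSn.
Qed.

(** An interval on which one term runs through a window of length [eps] is stretched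
by the factor [kap * rate ^+ K], that is to length 2 at least, after [K.*2]
further steps; so it contains an interval on which the later term runs
through such a window as well. Nesting these intervals produces a trajectory
that hits the window at every [K.*2]-th index. *)
Lemma nested_hits X (s0 s1 eps kap : R) K n1 :
  log_family a1 a2 b1 b2 X -> s0 < s1 -> 0 < eps <= 1 -> 0 < kap ->
  (0 < K)%N -> 2 <= kap * rate b1 b2 ^+ K * eps ->
  (forall s m k, s0 <= s <= s1 -> (n1 <= m)%N ->
    kap * rate b1 b2 ^+ k * fslope X s m <= fslope X s (m + k.*2)) ->
  exists M, forall r, exists2 s, s0 < s < s1 &
    r.+1%:R <= ncount (hit eps (X s)) (M + r * K.*2).+1 :> R.
Proof.
move=> famX s01 eps01 kap0 K0 hK growth.
have /andP[eps0 eps1] := eps01.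
pose f n s := log10 (X s n.+1).
pose d n s := fslope X s n.+1 / ln 10.
have ch n : chart (f n) (d n) := family_chart a1_gt0 a2_gt0 b1_gt1 b2_gt1 n famX.
have [n2 hn2] := family_slope_unbounded a1_gt0 a2_gt0 b1_gt1 b2_gt1 famX s0
  (2 * ln 10 / (s1 - s0)).
pose M := (n1 + n2)%N.
have s10 : 0 < s1 - s0 by rewrite subr_gt0.
have startM : 2 <= f M s1 - f M s0.
  have [_ _ sub] := ch M; apply: le_trans (sub s0 s1).
  have h := hn2 M.+1 (leq_trans (leq_addl n1 n2) (leqnSn _)).
  rewrite /d mulrAC ler_pdivlMr ?ln10_gt0 //.
  by rewrite -ler_pdivrMr.
have expand n u v : (n1 <= n)%N -> s0 <= u -> u <= v -> v <= s1 ->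
    kap * rate b1 b2 ^+ K * (f n v - f n u) <= f (n + K.*2)%N v - f (n + K.*2)%N u.
  move=> hn hu uv hv; apply: (chart_compare (ch _) (ch _)) => //.
    by rewrite mulr_ge0 ?exprn_ge0 // ltW // (lt_trans ltr01) // rate_gt1.
  move=> s /andP[us sv]; rewrite /d mulrA ler_pM2r ?invr_gt0 ?ln10_gt0 //.
  rewrite -addSn; apply: growth; first by rewrite (le_trans hu) //= (le_trans sv).
  exact: leqW.
have nest r : exists u v, [/\ s0 <= u, u < v, v <= s1,
   forall i, (i <= r)%N -> exists k : int,
     k%:~R <= f (M + i * K.*2)%N u /\ f (M + i * K.*2)%N v <= k%:~R + eps &
   f (M + r * K.*2)%N v - f (M + r * K.*2)%N u = eps].
  elim: r => [|r [u [v [hu uv hv hi hr]]]].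
    have [k [u [v [hu uv hv fu fv]]]] :=
      chart_window (ch M) eps01 (ltW s01) startM.
    exists u, v; split=> //; last by rewrite mul0n addn0 fu fv; ring.
    by case=> // _; exists k; rewrite mul0n addn0 fu fv.
  have big : 2 <= f (M + r.+1 * K.*2)%N v - f (M + r.+1 * K.*2)%N u.
    rewrite mulSn addnCA addnC; apply: le_trans (expand _ _ _ _ hu (ltW uv) hv).
      by rewrite hr.
    by rewrite /M -!addnA leq_addr.
  have [k [u' [v' [hu' uv' hv' fu fv]]]] := chart_window (ch _) eps01 (ltW uv) big.
  exists u', v'; split=> //; [exact: le_trans hu'|exact: le_trans hv| |].
    move=> i; rewrite leq_eqVlt ltnS => /predU1P[->|ir].
      by exists k; rewrite fu fv.
    have [j [h1 h2]] := hi i ir; exists j; split.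
      by apply: (le_trans h1); apply: chart_le (ch _) _.
    by apply: le_trans h2; apply: chart_le (ch _) _.
  by rewrite fu fv; ring.
exists M.+1 => r; have [u [v [hu uv hv hi _]]] := nest r.
exists ((u + v) / 2); first by apply/andP; split; lra.
apply: ncount_spaced; first by rewrite double_gt0.
move=> i ir; have [k [h1 h2]] := hi i ir; rewrite /hit addSn.
have fu : f (M + i * K.*2)%N u < f (M + i * K.*2)%N ((u + v) / 2).
  by apply: (chart_lt (ch _)); lra.
have fv : f (M + i * K.*2)%N ((u + v) / 2) < f (M + i * K.*2)%N v.
  by apply: (chart_lt (ch _)); lra.
rewrite -/(f (M + i * K.*2)%N ((u + v) / 2)) (@fpartE _ k).
  by apply/andP; split; lra.
by apply/andP; split; lra.
Qed.

End Nested.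

(** * Meagreness *)

(** A window of length [1 / (4 * K)] hit at every [K.*2]-th index is hit twice too
often for equidistribution. The stretching needed for this is available for
large [K], because a geometric sequence outgrows a linear one. *)
Lemma exists_spacing {R : realType} (lam kap : R) : 1 < lam -> 0 < kap ->
  exists2 K, (0 < K)%N & 2 <= kap * lam ^+ K * (1 / (4 * K%:R)).
Proof.
move=> lam1 kap0; have l0 : 0 < lam - 1 by rewrite subr_gt0.
have c0 : 0 < kap * (lam - 1) ^+ 2 by rewrite mulr_gt0 // exprn_gt0.
have [j hj] := exists_nat_ge (16 / (kap * (lam - 1) ^+ 2)).
have j1 : (0 < j)%N.
  by rewrite -(ltr0n R); apply: lt_le_trans hj; rewrite divr_gt0.
have j0 : 0 < j%:R :> R by rewrite ltr0n.
exists j.*2; first by rewrite double_gt0.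
have hb : (j%:R * (lam - 1)) ^+ 2 <= lam ^+ j.*2.
  have b0 : 0 <= j%:R * (lam - 1) by rewrite mulr_ge0 // ltW.
  have bj := bernoulli j lam1.
  rewrite -muln2 exprM ler_pXn2r ?nnegrE //; last by lra.
  by apply: le_trans bj; rewrite lerDr.
rewrite ler_pdivrMr // in hj.
have -> : (j.*2)%:R = 2 * j%:R :> R by rewrite -muln2 natrM mulrC.
rewrite mulrA mulr1 ler_pdivlMr ?mulr_gt0 //.
apply: (@le_trans _ _ (kap * (j%:R * (lam - 1)) ^+ 2)); last by rewrite ler_pM2l.
have := ler_wpM2l (ltW j0) hj.
by rewrite exprMn expr2; lra.
Qed.

Lemma spaced_length (M k K : nat) : (0 < K)%N ->
  let N := (M + (M + k).+1 * K.*2).+1 in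
  (k <= N)%N /\ (N < (M + k).+2 * (3 * K))%N.
Proof.
move=> K0 /=; have rK : ((M + k).+1 <= (M + k).+1 * K)%N by rewrite leq_pmulr.
have -> : ((M + k).+1 * K.*2 = 2 * ((M + k).+1 * K))%N by rewrite -muln2; ring.
have -> : ((M + k).+2 * (3 * K) = 3 * ((M + k).+1 * K) + 3 * K)%N by ring.
by move: rK; move: (_ * K)%N => p; split; lia.
Qed.

Section Meagre.
Context {R : realType}.
Variables (a1 a2 b1 b2 : R).
Hypotheses (a1_gt0 : 0 < a1) (a2_gt0 : 0 < a2).
Hypotheses (b1_gt1 : 1 < b1) (b2_gt1 : 1 < b2).
Notation rseq := (rec_seq a1 a2 b1 b2).

Lemma continuous_powR (b x : R) : 0 < x -> {for x, continuous (@powR R ^~ b)}.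
Proof.
move=> x0; apply: differentiable_continuous; apply/derivable1_diffP.
by apply: derivable_powR; rewrite in_itv /= x0.
Qed.

Lemma continuous_rec (x : R * R) n : pos_quadrant x ->
  {for x, continuous (fun z : R * R => rseq z n)}.
Proof.
move=> px; have pos k := solution_gt0 a1_gt0 a2_gt0 k (rec_solution a1 a2 b1 b2 px).
suff [] : {for x, continuous (fun z : R * R => rseq z n)} /\
          {for x, continuous (fun z : R * R => rseq z n.+1)} by [].
elim: n => [|n [IH0 IH1]].
  by split; [exact: cvg_fst | exact: cvg_snd].
split=> //.
have cpow (f : R * R -> R) a b : {for x, continuous f} -> 0 < f x ->
    {for x, continuous (fun z => a * f z `^ b)}.
  move=> cf fx; apply: continuousM; first exact: cvg_cst.
  exact: (continuous_comp cf (continuous_powR fx)).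
apply: continuousD.
  exact: (cpow (fun z => rseq z n.+1)).
exact: (cpow (fun z => rseq z n)).
Qed.

Lemma near_hit (eps : R) (x : R * R) n : pos_quadrant x -> eps <= 1 ->
  hit eps (rseq x) n -> \forall z \near x, hit eps (rseq z) n.
Proof.
move=> px eps1 /andP[h0 h1].
have pos k := solution_gt0 a1_gt0 a2_gt0 k (rec_solution a1 a2 b1 b2 px).
have cl : {for x, continuous (fun z : R * R => log10 (rseq z n))}.
  apply: continuousM; last exact: cvg_cst.
  exact: (continuous_comp (continuous_rec px) (continuous_ln (pos n))).
pose k := Num.floor (log10 (rseq x n)).
have itvx : log10 (rseq x n) \in `]k%:~R, k%:~R + eps[.
  by move: h0 h1; rewrite /fpart -/k in_itv /=; lra.
have near_itv : \forall z \near x, log10 (rseq z n) \in `]k%:~R, k%:~R + eps[.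
  exact: cl _ (near_in_itvoo itvx).
apply: filterS near_itv => z /=.
rewrite in_itv /= => /andP[z0 z1]; rewrite /hit (@fpartE _ k).
  by apply/andP; split; lra.
by apply/andP; split; lra.
Qed.

Lemma near_ncount (eps c : R) (x : R * R) N : pos_quadrant x -> eps <= 1 ->
  c < ncount (hit eps (rseq x)) N ->
  \forall z \near x, c < ncount (hit eps (rseq z)) N.
Proof.
move=> px eps1 hc.
have each (i : 'I_N) : \forall z \near x, hit eps (rseq x) i -> hit eps (rseq z) i.
  have [hi|hi] := boolP (hit eps (rseq x) i); last first.
    by apply: (@filterE _ (nbhs x)) => z.
  by apply: filterS (near_hit px eps1 hi).
apply: filterS (filter_forall _ each) => z hz; apply: (lt_le_trans hc).
apply: ler_sum => i _; rewrite ler_nat.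
by have := hz i; case: (hit eps (rseq x) i) => // ->.
Qed.

Lemma dense_hits : exists2 K, (0 < K)%N & forall (x : R * R) (U : set (R * R)) k,
  pos_quadrant x -> nbhs x U -> exists z N, [/\ U z, pos_quadrant z, (k <= N)%N &
    N%:R / (3 * K%:R) < ncount (hit (1 / (4 * K%:R)) (rseq z)) N :> R].
Proof.
have [kap kap0 growth] := family_growth a1_gt0 a2_gt0 b1_gt1 b2_gt1.
have [K K0 hK] := exists_spacing (rate_gt1 b1_gt1 b2_gt1) kap0.
have K1 : 1 <= K%:R :> R by rewrite ler1n.
exists K => // -[x1 x2] U k [/= x10 x20] nU.
have cpath : {for ln x2, continuous (fun s => (x1, expR s))}.
  apply: (@cvg_pair _ _ _ (nbhs (ln x2)) (nbhs x1) (nbhs (expR (ln x2))) _ _ _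
    (fun=> x1) (@expR R)); [exact: cvg_cst | exact: continuous_expR].
have nU' : nbhs (x1, expR (ln x2)) U by rewrite lnK ?posrE.
have /nbhs_ballP[e /= e0 he] := cpath _ nU'.
have famX := vertical_family a1 a2 b1 b2 x10.
have [r [r' [h1 h2 h3 esc]]] :=
  settled_interval a1_gt0 a2_gt0 b1_gt1 b2_gt1 (ln x2) famX e0.
have [n1 hn1] := growth _ r r' famX (ltW h2) esc.
have eps01 : 0 < (1 / (4 * K%:R) : R) <= 1.
  by rewrite divr_gt0 ?mulr_gt0 ?ltr0n //= ler_pdivrMr ?mulr_gt0 ?ltr0n //; lra.
have [M hM] := nested_hits a1_gt0 a2_gt0 b1_gt1 b2_gt1 famX h2 eps01 kap0 K0 hK hn1.
have [s /andP[rs sr'] hs] := hM (M + k).+1.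
have [kN Nsmall] := spaced_length M k K0.
(* So many windows are hit that the first [M] indices, of which nothing is
   known, do not matter. *)
exists (x1, expR s), (M + (M + k).+1 * K.*2).+1; split.
- by apply: he; rewrite /ball /= ltr_norml; apply/andP; split; lra.
- by split => //=; exact: expR_gt0.
- exact: kN.
apply: lt_le_trans hs.
rewrite ltr_pdivrMr ?mulr_gt0 ?ltr0n // -!natrM ltr_nat.
exact: Nsmall.
Qed.

(** A Benford sequence hits the window with frequency [1 / (4 * K)], hence less than
[1 / (3 * K)] of the time from some index on. For a fixed index this describes
a closed set of initial values by [near_ncount], and its interior is empty by
[dense_hits]. *)
Lemma benford_meagre : meagre_in pos_quadrant
  [set x : R * R | pos_quadrant x /\ benford (rseq x)].
Proof.
have [K K0 dense] := dense_hits.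
have K1 : 1 <= K%:R :> R by rewrite ler1n.
pose eps : R := 1 / (4 * K%:R).
have eps0 : 0 < eps by rewrite divr_gt0 ?mulr_gt0 ?ltr0n.
have eps1 : eps < 1.
  by rewrite /eps ltr_pdivrMr ?mulr_gt0 ?ltr0n //; lra.
pose rare k (x : R * R) := forall N, (k <= N)%N ->
  ncount (hit eps (rseq x)) N <= N%:R / (3 * K%:R) :> R.
exists (fun k => [set y : set_type (@pos_quadrant R) |
  (pos_quadrant (set_val y) /\ benford (rseq (set_val y))) /\ rare k (set_val y)]).
split.
  move=> k; apply/seteqP; split=> // y.
  case=> O [[U oU UO] Oy] sub_closure.
  have nU : nbhs (set_val y) U.
    by apply: open_nbhs_nbhs; split => //; rewrite -UO in Oy.
  have py : pos_quadrant (set_val y) by exact: set_valP.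
  have [z [N [Uz pz kN hN]]] := dense _ _ k py nU.
  pose z' : set_type (@pos_quadrant R) := exist _ z (mem_set pz).
  have Oz : O z' by rewrite -UO.
  have nz := near_ncount pz (ltW eps1) hN.
  have : nbhs z' (set_val @^-1` [set w | N%:R / (3 * K%:R) <
      ncount (hit eps (rseq w)) N :> R]).
    exact: (@initial_continuous _ _ set_val z').
  move=> /(sub_closure _ Oz)[w [[_ hw] /= lw]].
  by have := hw N kN; rewrite leNgt lw.
apply/seteqP; split=> y /=; last by case=> k _ [].
move=> [py by_]; pose t : R := expR (eps * ln 10).
have l10 : 0 < ln 10 :> R := ln10_gt0.
have logt : log10 t = eps by rewrite /log10 expRK mulfK // gt_eqF.
have t1 : 1 <= t < 10.
  apply/andP; split; first by rewrite -[1]expR0 ler_expR mulr_ge0 ?ltW.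
  rewrite -[ltRHS]lnK ?posrE // ltr_expR -[ltRHS]mul1r.
  by rewrite ltr_pM2r.
have gap : 0 < 1 / (3 * K%:R) - eps.
  by rewrite subr_gt0 /eps !div1r ltf_pV2 ?posrE ?mulr_gt0 ?ltr0n //; lra.
have posx k := solution_gt0 a1_gt0 a2_gt0 k (rec_solution a1 a2 b1 b2 py).
have [N0 hN0] := benford_ncount by_ posx t1 gap.
exists N0 => //; split => // N hN.
apply: le_trans (le_trans (hN0 N hN) _).
  apply: ncount_le => j /andP[_ h]; rewrite logt; exact: ltW.
by rewrite logt subrKC mulrC mulrA mulr1.
Qed.

End Meagre.

Theorem theorem6p1 (R : realType) (a1 a2 b1 b2 : R)
    (a1_gt0 : 0 < a1) (a2_gt0 : 0 < a2) (b1_gt1 : 1 < b1) (b2_gt1 : 1 < b2) :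
  let X : set (R * R) := pos_quadrant in
  let B := [set x : R * R | X x /\ benford (rec_seq a1 a2 b1 b2 x)] in
  full_measure_in X B /\ meagre_in X B.
Proof.
split.
  exact: benford_full_measure a1_gt0 a2_gt0 b1_gt1 b2_gt1.
exact: benford_meagre a1_gt0 a2_gt0 b1_gt1 b2_gt1.
Qed.
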